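(* Let $R$ be a round gap of degree $i\ge 1$ (under $\sigma_d$) and let $P$ be an $n$-gon, $n\ge 2$, contained in $\sigma_d(R)$. Let $f(i,n)$ denote the number of sibling portraits of $P$ in $R$ all of whose polygons map one-to-one onto $P$. Then $$f(i,n)=\frac{\binom{ni}{i}}{(n-1)i+1}.$$
   Context: The circle $\mathbb S=\mathbb R/\mathbb Z$ is the boundary of the closed unit disk; $\sigma_d(\theta)=d\theta\bmod 1$, $d\ge2$. A lamination is a closed set of chords of the unit disk that do not cross except possibly at endpoints, together with all points of the circle; leaves are its nondegenerate chords. A round gap is the closure of a component of the complement of a lamination that has arcs of the circle in its boundary; the empty lamination has one round gap, the whole disk (which has degree $d$). The map $\sigma_d$ acts on chords through endpoints, on arcs pointwise, and on a region bounded by arcs and leaves by sending it to the region bounded by the images of the parts of its boundary. A round gap $R$ has degree $i$ if $\sigma_d|_{\mathrm{Bd}(R)}$ is a positively oriented covering map of degree $i$. A polygon ($n$-gon) is the convex hull of a finite set of $n\ge 2$ points of the circle; a lone leaf is a 2-gon and is regarded as having two sides (one from $a$ to $b$ and one from $b$ to $a$). The image of a polygon is the convex hull of the images of its vertices. Given a round gap $R$ of degree $i$ and a polygon $P$ contained in $\sigma_d(R)$, a sibling portrait (of $P$ in $R$) is a set of pairwise disjoint polygons (disjoint even at vertices) inside $R$ that map to $P$ and which together have exactly $i$ sides mapping to each side of $P$. *)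

(* Defs.v *)
From mathcomp Require Import all_boot all_order all_algebra finmap.
From mathcomp Require Import all_classical all_reals all_analysis.

Set Implicit Arguments.
Unset Strict Implicit.
Unset Printing Implicit Defensive.

Import Order.TTheory GRing.Theory Num.Theory.
Import numFieldNormedType.Exports.

Local Open Scope classical_set_scope.
Local Open Scope ring_scope.

(** A point of the circle R/Z is given by its representative in [0, 1[; pt is
    the embedding of R/Z as the boundary of the closed unit disk of the plane
    R * R.  The product topology on R * R is the Euclidean one. *)
Section circle.
Variable R : realType.
Implicit Types (a b x : R) (d : nat).

Definition circle : set R := [set x | 0 <= x < 1].

Definition frac x : R := x - (Num.floor x)%:~R.

Definition sigma d x : R := frac (d%:R * x).

Definition pt x : R * R := (cos (2 * pi * x), sin (2 * pi * x)).

Definition disk : set (R * R) := [set z | z.1 ^+ 2 + z.2 ^+ 2 <= 1].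

(** x is in the open arc swept counterclockwise from a to b *)
Definition in_arc a b x : bool := 0 < frac (x - a) < frac (b - a).

End circle.
Arguments circle {R}.
Arguments disk {R}.

Section plane.
Variable R : realType.
Implicit Types (a b t : R) (A K : set (R * R)).

Definition chord_at a b t : R * R := (1 - t) *: pt a + t *: pt b.

Definition chord a b : set (R * R) := chord_at a b @` [set t | 0 <= t <= 1].

Definition convex_hull A : set (R * R) :=
  \bigcap_(C in [set C : set (R * R) | convex_set C /\ A `<=` C]) C.

Definition boundary K : set (R * R) := closure K `\` interior K.

(** The points of A together with those lying in a bounded component of the
    complement of A. *)
Definition region_bounded_by A : set (R * R) :=
  A `|` [set z | ~ A z /\ bounded_set (connected_component (~` A) z)].

End plane.

Section laminations.
Variable R : realType.
Implicit Types (L : set (R * R)) (G : set (R * R)) (d i : nat).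

(** A chord is given by the pair of its endpoints, so a lamination L is a
    symmetric set of pairs of angles.  The points of the circle are the
    degenerate chords (a, a); closedness is for the topology of the circle,
    hence the passage through pt. *)
Definition lamination L : Prop :=
  [/\ forall a b, L (a, b) -> circle a /\ circle b,
      forall a b, L (a, b) -> L (b, a),
      forall a, circle a -> L (a, a),
      closed [set (pt p.1, pt p.2) | p in L] &
      forall a b a' b', L (a, b) -> L (a', b') -> chord a b <> chord a' b' ->
        chord a b `&` chord a' b' `<=` [set pt a; pt b] `&` [set pt a'; pt b']].

Definition lamination_union L : set (R * R) :=
  \bigcup_(p in L) chord p.1 p.2.

Definition round_gap L G : Prop :=
  (exists z, (disk `\` lamination_union L) z /\
     G = closure (connected_component (disk `\` lamination_union L) z)) /\
  (exists a b, a < b /\ forall x, a <= x <= b -> boundary G (pt x)).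

(** The leaves and the points of the circle (degenerate chords) that make up
    the boundary of G. *)
Definition boundary_chord L G (a b : R) : Prop :=
  L (a, b) /\ chord a b `<=` boundary G.

Definition gap_image d L G : set (R * R) :=
  region_bounded_by [set z | exists a b,
    boundary_chord L G a b /\ chord (sigma d a) (sigma d b) z].

(** f is sigma_d on the circle points of Bd(G), and maps each boundary leaf
    affinely onto the chord joining the images of its endpoints. *)
Definition boundary_action d L G (f : R * R -> R * R) : Prop :=
  forall a b t, boundary_chord L G a b -> 0 <= t <= 1 ->
    f (chord_at a b t) = chord_at (sigma d a) (sigma d b) t.

Definition homeomorphism_between (A B : set (R * R)) (f : R * R -> R * R) :=
  [/\ {within A, continuous f}, f @` A = B &
      exists g : R * R -> R * R,
        {within B, continuous g} /\ forall x, A x -> g (f x) = x].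

(** f restricts to an i-sheeted covering map from A onto B. *)
Definition covering_map i (A B : set (R * R)) (f : R * R -> R * R) : Prop :=
  [/\ {within A, continuous f}, f @` A = B &
      forall y, B y -> exists (V : set (R * R)) (U : 'I_i -> set (R * R)),
        [/\ open V, V y, forall k, open (U k),
            trivIset [set: 'I_i] (fun k => A `&` U k) &
            A `&` f @^-1` V = \bigcup_k (A `&` U k) /\
            forall k, homeomorphism_between (A `&` U k) (B `&` V) f]].

(** g is a 1-periodic parametrization of Bd(K) as a simple closed curve with
    winding number 1 around an interior point c of K. *)
Definition positive_parametrization (K : set (R * R)) (g : R -> R * R) : Prop :=
  [/\ continuous g,
      forall t, g (t + 1) = g t,
      {in `[0, 1[ &, injective g},
      range g = boundary K &
      exists (c : R * R) (r theta : R -> R),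
        [/\ interior K c, continuous theta,
            forall t, theta (t + 1) = theta t + 1 &
            forall t, 0 < r t /\ g t = c + r t *: pt (theta t)]].

(** f lifts, through positive parametrizations of Bd(K) and Bd(K'), to an
    increasing map of the line. *)
Definition positively_oriented (K K' : set (R * R)) (f : R * R -> R * R) :=
  exists (g g' : R -> R * R) (F : R -> R),
    [/\ positive_parametrization K g, positive_parametrization K' g',
        continuous F, {homo F : s t / s < t} &
        forall t, f (g t) = g' (F t)].

Definition gap_degree d L G i : Prop :=
  exists f : R * R -> R * R,
    [/\ boundary_action d L G f,
        covering_map i (boundary G) (boundary (gap_image d L G)) f &
        positively_oriented G (gap_image d L G) f].

End laminations.

(** A polygon is represented by the finite set of its vertices, and the polygon
    as a subset of the plane is its hull. *)
Section polygons.
Variable R : realType.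
Implicit Types (V W P : {fset R}) (Q : {fset {fset R}}) (d i : nat).

Definition polygon V : Prop :=
  [set` V] `<=` circle /\ (2 <= #|` V|)%N.

Definition hull V : set (R * R) := convex_hull [set pt x | x in [set` V]].

Definition polygon_image d V : {fset R} := [fset sigma d x | x in V]%fset.

(** The sides are oriented counterclockwise: (a, b) is a side when b is the
    vertex following a.  A 2-gon {a, b} has the two sides (a, b) and (b, a). *)
Definition sides V : {fset R * R} :=
  [fset s in (V `*` V)%fset |
    (s.1 != s.2) && all (fun x => ~~ in_arc s.1 s.2 x) V]%fset.

Definition sides_over d V (s : R * R) : {fset R * R} :=
  [fset e in sides V | (sigma d e.1, sigma d e.2) == s]%fset.

Definition sibling_portrait d (G : set (R * R)) i P Q : Prop :=
  [/\ forall V, V \in Q ->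
        [/\ polygon V, hull V `<=` G & polygon_image d V = P],
      forall V W, V \in Q -> W \in Q -> V != W -> hull V `&` hull W = set0 &
      forall s, s \in sides P -> (\sum_(V <- Q) #|` sides_over d V s|)%N = i].

Definition one_to_one_portraits d (G : set (R * R)) i P : set {fset {fset R}} :=
  [set Q | sibling_portrait d G i P Q /\
           forall V, V \in Q -> {in V &, injective (sigma d)}].

End polygons.

(* Main.v *)
Require Import Defs.
From mathcomp Require Import all_boot all_order all_algebra finmap.
From mathcomp Require Import all_classical all_reals all_analysis.
From mathcomp Require Import zify ring lra.

Set Implicit Arguments.
Unset Strict Implicit.
Unset Printing Implicit Defensive.

(** Write G for the gap, K for its image and N = n * i.  The vertices of P have
    exactly N preimages on the circle part of Bd(G), and going around Bd(G)
    counterclockwise their images run i times through the vertices of P in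
    cyclic order ([portrait_vertices]).

    Granted this, a polygon of a portrait uses one preimage of each vertex of
    P, so it has at most one side over each side of P; since i sides are needed
    there are i polygons, and they use up all N preimages.  Two polygons
    inscribed in a circle are disjoint exactly when their vertex sets do not
    cross ([crossing_hulls], [noncrossing_blocks_disjoint_hulls]), so portraits
    are noncrossing partitions of N cyclically ordered points into blocks of n
    points.  Conversely each such partition is a portrait: between two
    consecutive points of a block lie whole blocks, hence a multiple of n points
    ([block_gap]), so a block meets every residue class modulo n once, in
    cyclic order, and its sides map to the sides of P ([one_side_over_block]).

    To count the partitions, consider more generally the families of b
    noncrossing n-blocks among the first k points in which no unmatched point
    is enclosed by a block.  The last point is unmatched, or it closes a block
    together with the n - 1 largest points that were unmatched before.  This
    gives the recursion [families_rec] of the ballot numbers, solved by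
    [card_families].

    The cyclic order rests on convexity.  A gap is cut out of the disk by the
    half-planes of the leaves ([gapP]), so it is convex, and its boundary
    consists of leaves and points of the circle ([gap_boundary_chord]).  No
    leaf of the boundary is collapsed to a point, because the fibres are
    finite; hence all preimages of vertices lie on the circle
    ([vertex_fibre]).  On the image side Bd(K) is a Jordan curve made of chords
    and points of the circle.  Deleting a chord from it leaves a connected set
    that cannot cross the line of the chord, which meets the disk in the chord
    only; so that line supports K ([chord_one_side]).  A curve
    with a supporting line at each of its points is met once by every ray
    from an interior point, so the angle seen from there increases along the
    curve ([angle_increasing]) and the points on the unit circle are visited in
    their cyclic order ([cyclic_enum_param]).  The increasing lift F of the
    covering then transports the order of the vertices of P to their
    preimages, and F 1 - F 0 is the number of sheets. *)

(** * Noncrossing families of blocks *)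

Section NoncrossingFamilies.
Import mathcomp.boot.fintype mathcomp.boot.finset.
Context {N : nat} (n : nat).
Implicit Types (A B U T : {set 'I_N}) (pi : {set {set 'I_N}}) (k b : nat).

(** The last clause, that no unmatched point lies between two points of a
    block, makes the block of the last point recoverable from the others. *)
Definition noncrossing_family k b pi : Prop :=
  [/\ #|pi| = b,
      forall B, B \in pi -> #|B| = n /\ forall x, x \in B -> x < k,
      forall A B x, A \in pi -> B \in pi -> x \in A -> x \in B -> A = B,
      forall A B (x y z t : 'I_N), A \in pi -> B \in pi ->
        x \in A -> z \in A -> y \in B -> t \in B -> x < y < z -> z < t -> A = B &
      forall B (x u y : 'I_N), B \in pi -> x \in B -> y \in B ->
        x < u < y -> u \in cover pi].

Definition families k b : {set {set {set 'I_N}}} :=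
  [set pi | `[< noncrossing_family k b pi >]].

Lemma familiesP k b pi :
  reflect (noncrossing_family k b pi) (pi \in families k b).
Proof. by rewrite inE; apply: asboolP. Qed.

Definition top_part T U : Prop :=
  T \subset U /\ forall t u, t \in T -> u \in U -> u \notin T -> u < t.

Lemma top_part_exists U k : k <= #|U| -> exists2 T, top_part T U & #|T| = k.
Proof.
elim: k => [|k IH] kU.
  exists set0; last by rewrite cards0.
  by split=> [|t u]; rewrite ?sub0set ?inE.
have [T [TU top] cT] := IH (ltnW kU).
have /card_gt0P[u0 u0P] : 0 < #|U :\: T|.
  by rewrite cardsD (setIidPr TU) cT subn_gt0.
pose u := [arg max_(x > u0 in (U :\: T)) val x].
have [uP umax] : u \in U :\: T /\ forall x, x \in U :\: T -> x <= u.
  by rewrite /u; case: arg_maxnP.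
move: uP; rewrite inE => /andP[uT uU].
exists (u |: T); last by rewrite cardsU1 uT cT.
split.
  by apply/subsetP=> x /setU1P[->//|xT]; apply: (subsetP TU).
move=> t x /setU1P[->|tT] xU; rewrite !inE negb_or => /andP[xu xT].
  by rewrite ltn_neqAle xu umax // inE xT.
exact: top.
Qed.

(** If both parts had a private point, each of these two points would be
    smaller than the other. *)
Lemma top_part_unique U T T' :
  top_part T U -> top_part T' U -> #|T| = #|T'| -> T = T'.
Proof.
move=> [TU top] [TU' top'] cT; apply/eqP; rewrite eqEcard cT leqnn andbT.
apply/negPn/negP=> /subsetPn[t tT tT'].
have : ~~ (T' \subset T).
  apply: contraNN tT' => sub.
  by have /eqP -> : T' == T by rewrite eqEcard sub cT leqnn.
case/subsetPn=> t' t'T' t'T.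
have h1 := top _ _ tT (subsetP TU' _ t'T') t'T.
have h2 := top' _ _ t'T' (subsetP TU _ tT) tT'.
by have := ltn_trans h1 h2; rewrite ltnn.
Qed.

Lemma family_trivIset k b pi : noncrossing_family k b pi -> trivIset pi.
Proof.
case=> _ _ dis _ _; apply/trivIsetP=> A B Api Bpi AB.
apply/pred0P=> x /=; apply/negP=> /andP[xA xB].
by move/eqP: AB; apply; apply: (dis _ _ x).
Qed.

Lemma family_card_cover k b pi :
  noncrossing_family k b pi -> #|cover pi| = b * n.
Proof.
move=> h; rewrite -(eqP (family_trivIset h)).
case: h => <- sz _ _ _; rewrite -sum_nat_const.
by apply: eq_bigr => B /sz[].
Qed.

Lemma family_cover_lt k b pi x :
  noncrossing_family k b pi -> x \in cover pi -> x < k.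
Proof. by case=> _ sz _ _ _ /bigcupP[B /sz[_]]; apply. Qed.

Lemma card_ord_lt k : k <= N -> #|[set x : 'I_N | x < k]| = k.
Proof.
move=> kN; rewrite -[RHS]card_ord.
have inj : injective (widen_ord kN) by move=> x y /(congr1 val) /= /val_inj.
rewrite -(card_imset _ inj); apply: eq_card => x; rewrite inE.
apply/idP/imsetP=> [xk|[y _ ->]]; last exact: (ltn_ord y).
by exists (Ordinal xk) => //; apply: val_inj.
Qed.

Lemma family_bound k b pi : k <= N -> noncrossing_family k b pi -> b * n <= k.
Proof.
move=> kN h; rewrite -(family_card_cover h) -[leqRHS](card_ord_lt kN).
by apply: subset_leq_card; apply/subsetP=> x xc; rewrite inE (family_cover_lt h).
Qed.

Lemma families0 k : families k 0 = [set set0].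
Proof.
apply/setP=> pi; rewrite in_set1; apply/familiesP/eqP=> [[/eqP]|->].
  by rewrite cards_eq0 => /eqP.
by split=> [|B|A B x|A B x y z t|B x u y]; rewrite ?cards0 ?inE.
Qed.

Lemma cover_D1 pi A x :
  trivIset pi -> A \in pi ->
  (x \in cover (pi :\ A)) = (x \in cover pi) && (x \notin A).
Proof.
move=> /trivIsetP tr Api; apply/bigcupP/idP=> [[B]|/andP[/bigcupP[B Bpi xB] xA]].
  rewrite !inE => /andP[BA Bpi] xB; rewrite (subsetP (bigcup_sup B Bpi)) //=.
  by have /pred0P/(_ x) /= := tr _ _ Bpi Api BA; rewrite xB /= => ->.
by exists B => //; rewrite !inE Bpi andbT; apply: contraNneq xA => <-.
Qed.

Definition unmatched k pi := [set x : 'I_N | x < k] :\: cover pi.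

Section LastPoint.
Variables (k b : nat) (kN : k < N).
Hypotheses (n_gt0 : 0 < n) (enough : b.+1 * n <= k.+1).
Let last : 'I_N := Ordinal kN.

Let closed : {set {set {set 'I_N}}} :=
  [set pi in families k.+1 b.+1 | last \in cover pi].

Let open_families : families k.+1 b.+1 :\: closed = families k b.+1.
Proof.
apply/setP=> pi; apply/setDP/familiesP=> [[/familiesP h]|h].
  rewrite inE (introT (familiesP _ _ _) h) /= => ncov.
  have [c sz dis cr enc] := h.
  split=> // B Bpi; have [sB lB] := sz B Bpi; split=> // x xB.
  rewrite ltn_neqAle -ltnS lB // andbT; apply: contraNneq ncov => xk.
  by apply/bigcupP; exists B => //; rewrite (_ : last = x) //; apply: val_inj.
have [c sz dis cr enc] := h; split; last first.
  by rewrite inE negb_and orbC; apply/orP; left; apply/negP=> /(family_cover_lt h); rewrite ltnn.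
apply/familiesP; split=> // B Bpi; have [sB lB] := sz B Bpi.
by split=> // x /lB /ltnW.
Qed.

Let rem pi := pi :\ pblock pi last.

Let closed_block pi : pi \in closed ->
  [/\ noncrossing_family k.+1 b.+1 pi, pblock pi last \in pi &
      last \in pblock pi last].
Proof.
by rewrite inE => /andP[/familiesP h c]; split; rewrite ?pblock_mem ?mem_pblock.
Qed.

Let rem_family pi : pi \in closed -> noncrossing_family k b (rem pi).
Proof.
move=> /closed_block[h]; rewrite /rem; set L := pblock _ _ => Lpi lL.
have tr := family_trivIset h.
have [c sz dis cr enc] := h.
split.
- by move: c; rewrite (cardsD1 L) Lpi => -[].
- move=> B; rewrite !inE => /andP[BL Bpi]; have [sB lB] := sz B Bpi; split=> // x xB.
  rewrite ltn_neqAle -ltnS lB // andbT; apply: contraNneq BL => xk.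
  by apply/eqP; apply: (dis _ _ x) => //; rewrite (_ : x = last) //; apply: val_inj.
- move=> A B x; rewrite !inE => /andP[_ Ap] /andP[_ Bp]; exact: dis.
- move=> A B x y z t; rewrite !inE => /andP[_ Ap] /andP[_ Bp]; exact: cr.
- move=> B x u y; rewrite !inE => /andP[BL Bpi] xB yB xuy.
  rewrite cover_D1 // (enc B x u y) //=; have nB := BL; apply: contraNN BL => uL.
  apply/eqP; apply: (cr B L x u y last) => //.
  have := (sz B Bpi).2 y yB; rewrite ltnS leq_eqVlt => /orP[/eqP yk|//].
  have BLeq : B = L.
    by apply: (dis _ _ y) => //; rewrite (_ : y = last) //; apply: val_inj.
  by exfalso; have := nB; rewrite BLeq eqxx.
Qed.

Let rem_top pi : pi \in closed ->
  top_part (pblock pi last :\ last) (unmatched k (rem pi)).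
Proof.
move=> pc; have [h] := closed_block pc; rewrite /unmatched /rem.
set L := pblock _ _ => Lpi lL.
have tr := family_trivIset h; have [c sz dis cr enc] := h.
split.
  apply/subsetP=> x; rewrite !inE cover_D1 // => /andP[xl xL].
  rewrite xL andbF /= ltn_neqAle -ltnS (sz L Lpi).2 // andbT.
  by apply: contraNneq xl => xk; apply/eqP/val_inj.
move=> t u; rewrite !inE cover_D1 // => /andP[tl tL] /andP[ncu uk].
have ul : u != last by apply: contraTneq uk => ->; rewrite ltnn.
rewrite ul /= => uL; rewrite ltnNge leq_eqVlt; apply/negP=> /orP[/eqP tu|tu].
  by move: uL; rewrite (_ : u = t) ?tL //; apply: val_inj.
by move: ncu; rewrite (enc L t u last) ?tu ?uL.
Qed.

Let block_pred_card pi : pi \in closed -> #|pblock pi last :\ last| = n.-1.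
Proof.
move=> /closed_block[[_ sz _ _ _] Lpi lL].
by have [] := sz _ Lpi; rewrite (cardsD1 last) lL => <-.
Qed.

Let rem_inj : {in closed &, injective rem}.
Proof.
move=> pi pi' pc pc' eq.
have L_eq : pblock pi last = pblock pi' last.
  have [_ _ lL] := closed_block pc; have [_ _ lL'] := closed_block pc'.
  rewrite -(setD1K lL) -(setD1K lL'); congr (_ |: _).
  apply: (@top_part_unique (unmatched k (rem pi))); first exact: rem_top.
    by rewrite eq; apply: rem_top.
  by rewrite !block_pred_card.
have [_ Lpi _] := closed_block pc; have [_ Lpi' _] := closed_block pc'.
by rewrite -(setD1K Lpi) -(setD1K Lpi') -/(rem pi) -/(rem pi') eq L_eq.
Qed.

Let rem_onto pi : noncrossing_family k b pi ->
  exists2 pi', pi' \in closed & rem pi' = pi.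
Proof.
move=> h; have [c sz dis cr enc] := h.
have cov_lt x : x \in cover pi -> x < k by apply: family_cover_lt.
have cardU : n.-1 <= #|unmatched k pi|.
  rewrite cardsD (setIidPr _); last by apply/subsetP=> x /cov_lt; rewrite inE.
  rewrite (family_card_cover h) card_ord_lt ?(ltnW kN) //.
  by move: enough; rewrite mulSn; lia.
have [T [TU top] cT] := top_part_exists cardU.
have TP t : t \in T -> t \notin cover pi /\ t < k.
  by move=> /(subsetP TU); rewrite !inE => /andP[].
have lT : last \notin T by apply/negP=> /TP[_]; rewrite ltnn.
pose L := last |: T.
have cL : #|L| = n by rewrite cardsU1 lT cT add1n prednK.
have disL B x : B \in pi -> x \in B -> x \in L -> False.
  move=> Bpi xB; have xc : x \in cover pi by apply/bigcupP; exists B.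
  case/setU1P=> [xl|/TP[]]; last by rewrite xc.
  by have := cov_lt x xc; rewrite xl ltnn.
have Lpi : L \notin pi.
  by apply/negP=> Lpi; apply: (disL L last) => //; apply: setU11.
have coverL : cover (L |: pi) = L :|: cover pi.
  by rewrite /cover bigcup_setU big_set1.
have hL : noncrossing_family k.+1 b.+1 (L |: pi).
  split.
  - by rewrite cardsU1 Lpi c.
  - move=> B /setU1P[->|Bpi].
      by split=> // x /setU1P[->//|/TP[_ /ltnW]].
    by have [? lB] := sz B Bpi; split=> // x /lB/ltnW.
  - move=> A B x /setU1P[->|Api] /setU1P[->|Bpi] // xA xB; last exact: (dis _ _ x).
      by case: (disL B x).
    by case: (disL A x).
  - move=> A B x y z t /setU1P[->|Api] /setU1P[->|Bpi] // xA zA yB tB xyz zt.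
    + have tk := (sz B Bpi).2 _ tB.
      case/setU1P: zA => [zl|/TP[zc _]]; first by move: zt; rewrite zl /= => /(ltn_trans tk); rewrite ltnn.
      by move: zc; rewrite (enc B y z t) // zt; case/andP: xyz => _ ->.
    + case/setU1P: yB => [yl|/TP[yc _]].
        have zk := (sz A Api).2 _ zA.
        by case/andP: xyz => _; rewrite yl => /(ltn_trans zk); rewrite ltnn.
      by move: yc; rewrite (enc A x y z).
    + exact: (cr A B x y z t).
  - move=> B x u y Bp xB yB xuy; rewrite coverL in_setU; apply/orP.
    case/setU1P: Bp => [BL|Bpi]; last by right; apply: (enc B x u y).
    case: (boolP (u \in cover pi)) => [|uc]; [by right|left].
    have uk : u < k.
      case/andP: xuy => _ uy; move: yB; rewrite BL => /setU1P[yl|/TP[_]].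
        by move: uy; rewrite yl.
      exact: ltn_trans.
    apply: contraT => uL; have uT : u \notin T by apply: contraNN uL => ?; apply/setU1P; right.
    move: xB; rewrite BL => /setU1P[xl|xT].
      by case/andP: xuy; rewrite xl /= => /(ltn_trans uk); rewrite ltnn.
    have := top x u xT; rewrite !inE uc uk uT => /(_ isT isT) ux.
    by case/andP: xuy => /(ltn_trans ux); rewrite ltnn.
have lc : last \in cover (L |: pi) by rewrite coverL !inE eqxx.
exists (L |: pi); first by rewrite inE lc andbT; apply/familiesP.
have -> : rem (L |: pi) = (L |: pi) :\ L.
  rewrite /rem; congr (_ :\ _); apply: def_pblock; rewrite ?setU11 //.
  exact: family_trivIset hL.
by apply/setP=> B; rewrite !inE; case: eqP => [->|]; rewrite ?(negPf Lpi).
Qed.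

(** Removing the block of the point k is injective: the rest of that block
    must be the n - 1 largest points unmatched by the other blocks, since any
    other choice would enclose an unmatched point.  Adding such a block to a
    family in the first k points creates no crossing, as its points were not
    enclosed. *)
Lemma families_rec :
  #|families k.+1 b.+1| = #|families k b.+1| + #|families k b|.
Proof.
rewrite -(cardsID closed) addnC open_families; congr (_ + _).
have -> : families k.+1 b.+1 :&: closed = closed.
  by apply/setIidPr/subsetP=> pi; rewrite inE => /andP[].
rewrite -(card_in_imset rem_inj); congr #|pred_of_set _|.
apply/setP=> pi; apply/imsetP/familiesP=> [[pi' pc ->]|/rem_onto[pi' ? <-]].
  exact: rem_family.
by exists pi'.
Qed.

End LastPoint.

(** The ballot numbers satisfy the recursion of [families_rec].  The
    truncated difference vanishes exactly when b blocks do not fit, which is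
    also the boundary value needed when the last block fills everything. *)
Lemma card_families k b : 0 < n -> k <= N ->
  #|families k b| * k.+1 = (k.+1 - b * n) * 'C(k.+1, b).
Proof.
move=> n_gt0; elim: k b => [|k IH] [|b] kN; try by rewrite families0 cards1 mul0n subn0 bin0; lia.
  rewrite (_ : families 0 b.+1 = set0) ?cards0; last first.
    apply/setP=> pi; rewrite in_set0; apply/familiesP=> /(family_bound kN).
    by rewrite mulSn; lia.
  by rewrite (_ : 1 - _ = 0) ?mul0n // mulSn; lia.
have [lt|ge] := ltnP k.+1 (b.+1 * n).
  rewrite (_ : families _ _ = set0) ?cards0; last first.
    apply/setP=> pi; rewrite in_set0; apply/familiesP=> /(family_bound kN).
    by lia.
  by rewrite (_ : k.+2 - _ = 0) ?mul0n; lia.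
rewrite (families_rec kN n_gt0 ge).
have h1 := IH b.+1 (ltnW kN); have h2 := IH b (ltnW kN).
have /= d1 := mul_bin_diag k.+2 b.
have bk : b <= k by nia.
have d2 : (k.+1 - b) * 'C(k.+2, b.+1) = k.+2 * 'C(k.+1, b.+1).
  have : k.+2 * 'C(k.+2, b.+1) = k.+2 * 'C(k.+1, b.+1) + b.+1 * 'C(k.+2, b.+1).
    by rewrite {1}binS mulnDr d1.
  by rewrite mulnBl !mulSn; lia.
apply/eqP; rewrite -(eqn_pmul2r (ltn0Sn k)); apply/eqP.
have -> : (#|families k b.+1| + #|families k b|) * k.+2 * k.+1
  = (#|families k b.+1| * k.+1) * k.+2 + (#|families k b| * k.+1) * k.+2 by rewrite mulnDl mulnDl mulnAC (mulnAC #|families k b|).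
rewrite h1 h2 -!mulnA ![_ * k.+2]mulnC -d2 d1 !mulnA -mulnDl [RHS]mulnAC; congr (_ * _).
have [e ek] : exists e, k.+1 = e + b.+1 * n by exists (k.+1 - b.+1 * n); lia.
have [e' ek'] : exists e', k.+1 = e' + b by exists (k.+1 - b); lia.
have -> : k.+1 - b.+1 * n = e by lia.
have -> : k.+1 - b * n = e + n by rewrite ek mulSn; lia.
have -> : k.+2 - b.+1 * n = e.+1 by lia.
have -> : k.+1 - b = e' by lia.
move: ek ek' => /[dup] ek -> ek'. nia.
Qed.

(** The points of [a, c[ outside B are filled by whole blocks: a block with
    points both inside and outside that interval would cross B. *)
Lemma block_gap pi i B (a c : 'I_N) :
  noncrossing_family N i pi -> cover pi = setT -> B \in pi ->
  a \in B -> c \in B -> a <= c ->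
  exists q, c = a + #|[set x in B | a <= x < c]| + q * n :> nat.
Proof.
move=> h full Bpi aB cB ac; have [_ sz dis cr _] := h.
pose I := [set x : 'I_N | a <= x < c].
pose tau := [set A in pi | (A != B) && ~~ [disjoint A & I]].
have tauI : cover tau = I :\: B.
  apply/setP=> x; apply/bigcupP/idP=> [[A]|].
    rewrite inE => /and3P[Api AB /pred0Pn[y /= /andP[yA]]]; rewrite inE => /andP[ay yc] xA.
    have xB : x \notin B by apply: contraNN AB => xB; apply/eqP/(dis _ _ x).
    have yB : y \notin B by apply: contraNN AB => yB; apply/eqP/(dis _ _ y).
    rewrite inE xB inE /=.
    have ay' : a < y.
      rewrite ltn_neqAle ay andbT; apply: contraNneq yB => ay'.
      by rewrite (_ : y = a) //; apply: val_inj.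
    apply/andP; split.
      rewrite leqNgt; apply: contraNN AB => xa.
      by apply/eqP; apply: (cr A B x a y c); rewrite ?xa.
    rewrite ltnNge; apply: contraNN AB => cx; apply/eqP/esym.
    apply: (cr B A a y c x); rewrite ?ay' // ltn_neqAle cx andbT.
    by apply: contraNneq xB => cx'; rewrite (_ : x = c) //; apply: val_inj.
  rewrite inE => /andP[xB xI].
  have /bigcupP[A Api xA] : x \in cover pi by rewrite full inE.
  exists A => //; rewrite inE Api /=; apply/andP; split.
    by apply: contraNneq xB => <-.
  by apply/pred0Pn; exists x; rewrite /= xA.
have trtau : trivIset tau.
  apply: trivIsetS (family_trivIset h); apply/subsetP=> A; rewrite inE.
  by case/andP.
have card_tau : #|I :\: B| = #|tau| * n.
  rewrite -tauI -(eqP trtau) -sum_nat_const; apply: eq_bigr => A.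
  by rewrite inE => /andP[/sz[]].
exists #|tau|; rewrite -card_tau -addnA.
have -> : [set x in B | a <= x < c] = I :&: B.
  by apply/setP=> x; rewrite !inE andbC.
rewrite cardsID.
have -> : #|I| = c - a; last by lia.
have -> : I = [set x : 'I_N | x < c] :\: [set x : 'I_N | x < a].
  by apply/setP=> x; rewrite !inE -leqNgt.
rewrite cardsD (setIidPr _); last by apply/subsetP=> x; rewrite !inE => /leq_trans; apply.
by rewrite !card_ord_lt // ltnW.
Qed.

End NoncrossingFamilies.

Import Order.TTheory GRing.Theory Num.Theory.
Import numFieldNormedType.Exports.
Local Open Scope classical_set_scope.
Local Open Scope ring_scope.

(** * The circle and its cyclic order *)

Section Circle.
Context {R : realType}.
Implicit Types (a b x y z t : R) (p q r w c : R * R).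

Definition ccw x y z : bool := [|| x < y < z, y < z < x | z < x < y].

Lemma ccw_rot a b x : ccw a b x = ccw b x a.
Proof. by rewrite /ccw orbC -orbA. Qed.

Lemma ccw_neq a b x : ccw a b x -> [/\ a != b, b != x & a != x].
Proof. by rewrite /ccw => h; split; apply/eqP; lra. Qed.

Lemma ccwC a b x : a != b -> b != x -> a != x -> ~~ ccw a b x = ccw a x b.
Proof.
rewrite /ccw; case: (ltgtP a b) => //; case: (ltgtP b x) => //;
  case: (ltgtP a x) => //= *; lra.
Qed.

Lemma frac_itv x : 0 <= Defs.frac x < 1.
Proof. by have := floor_itv x; rewrite /Defs.frac intrD; lra. Qed.

Lemma frac_id x : 0 <= x < 1 -> Defs.frac x = x.
Proof. by move=> h; rewrite /Defs.frac (@floor_def _ x 0) ?subr0 //= ?intrD; lra. Qed.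

Lemma frac_neg x : -1 <= x < 0 -> Defs.frac x = x + 1.
Proof. by move=> h; rewrite /Defs.frac (@floor_def _ x (-1)) ?opprK //= ?intrD; lra. Qed.

Lemma circle_sigma d x : circle (sigma d x).
Proof. by have := frac_itv (d%:R * x). Qed.

(** With representatives in [0, 1[ the fractional parts unwind to a cyclic
    order of real numbers, free of any reduction modulo 1. *)
Lemma in_arcE a b x : circle a -> circle b -> circle x ->
  in_arc a b x = ccw a x b.
Proof.
rewrite /circle /in_arc /ccw /= => ha hb hx.
have fracE y : 0 <= y < 1 -> Defs.frac (y - a) = if a <= y then y - a else y - a + 1.
  by move=> hy; case: leP => ay; [apply: frac_id|apply: frac_neg]; lra.
by rewrite !fracE //; case: (leP a x) => ax; case: (leP a b) => ab;
  apply/idP/idP; lra.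
Qed.

Lemma pt_norm x : (pt x).1 ^+ 2 + (pt x).2 ^+ 2 = 1.
Proof. exact: cos2Dsin2. Qed.

Lemma ptD1 x : pt (x + 1) = pt x.
Proof.
rewrite /pt mulrDr mulr1 (mulrC 2) (mulr_natr pi 2) -(mulr_natr pi 2).
by rewrite (mulr_natr pi 2) cosD2pi sinD2pi.
Qed.

(** Twice the signed area of the triangle p, q, r: positive when r lies to
    the left of the line from p to q. *)
Definition det3 p q r : R :=
  (q.1 - p.1) * (r.2 - p.2) - (q.2 - p.2) * (r.1 - p.1).

Lemma det3_pt x y z : det3 (pt x) (pt y) (pt z) =
  4 * sin (pi * (y - x)) * sin (pi * (z - y)) * sin (pi * (z - x)).
Proof.
have e (u v : R) : (pt u).1 * (pt v).2 - (pt u).2 * (pt v).1 = sin (2 * (pi * (v - u))).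
  by rewrite /pt /= !mulrBr sinB !mulrA; ring.
have -> : det3 (pt x) (pt y) (pt z) =
  ((pt x).1 * (pt y).2 - (pt x).2 * (pt y).1) +
  ((pt y).1 * (pt z).2 - (pt y).2 * (pt z).1) -
  ((pt x).1 * (pt z).2 - (pt x).2 * (pt z).1).
  by rewrite /det3; ring.
rewrite !e; set u := pi * (y - x); set v := pi * (z - y).
have -> : pi * (z - x) = u + v by rewrite /u /v; ring.
have s2 t : sin (2 * t) = 2 * sin t * cos t.
  by rewrite mulr_natl sin_mulr2n -mulr_natl; ring.
rewrite !s2 sinD cosD.
have cu := cos2Dsin2 u; have cv := cos2Dsin2 v.
have cu' : cos u ^+ 2 = 1 - sin u ^+ 2 by rewrite -cu; ring.
have cv' : cos v ^+ 2 = 1 - sin v ^+ 2 by rewrite -cv; ring.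
transitivity (2 * sin u * cos u * (1 - cos v ^+ 2 + sin v ^+ 2) +
  2 * sin v * cos v * (1 - cos u ^+ 2 + sin u ^+ 2)); first by ring.
by rewrite cu' cv'; ring.
Qed.

Lemma sgr_sin_pi x : -1 < x < 1 -> Num.sg (sin (pi * x)) = Num.sg x.
Proof.
have pi0 := @pi_gt0 R.
have pos y : 0 < y < 1 -> 0 < sin (pi * y).
  by move=> h; apply: sin_gt0_pi; apply/andP; split; nra.
move=> h; case: (ltgtP x 0) => x0; last by rewrite x0 mulr0 sin0.
  have sx : 0 < sin (pi * - x) by apply: pos; lra.
  by rewrite mulrN sinN oppr_gt0 in sx; rewrite !ltr0_sg.
by rewrite !gtr0_sg ?pos //; lra.
Qed.

Lemma sgr_det3_pt x y z : circle x -> circle y -> circle z ->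
  Num.sg (det3 (pt x) (pt y) (pt z)) = Num.sg ((y - x) * (z - y) * (z - x)).
Proof.
rewrite /circle /= => hx hy hz.
rewrite det3_pt !sgrM !sgr_sin_pi ?(gtr0_sg (x := 4)) ?mul1r //; lra.
Qed.

(** By [det3_pt] the sign is that of a product of sines of pi * t with
    |t| < 1, hence that of the product of the differences. *)
Lemma det3_gt0 x y z : circle x -> circle y -> circle z ->
  (0 < det3 (pt x) (pt y) (pt z)) = ccw x y z.
Proof.
move=> hx hy hz; rewrite -sgr_gt0 sgr_det3_pt // sgr_gt0 /ccw.
have [<-|xy] := eqVneq x y; first by rewrite subrr !mul0r !ltxx; lra.
have [<-|yz] := eqVneq y z; first by rewrite subrr mulr0 mul0r !ltxx; lra.
have [<-|xz] := eqVneq x z; first by rewrite subrr mulr0 !ltxx; lra.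
have pos (u v : R) : u < v -> 0 < v - u by rewrite subr_gt0.
have neg (u v : R) : u < v -> u - v < 0 by rewrite subr_lt0.
case: (ltgtP x y) xy => // xy _; case: (ltgtP y z) yz => // yz _;
  case: (ltgtP x z) xz => // xz _ /=;
  rewrite ?(nmulr_lgt0 _ (neg _ _ xz)) ?(pmulr_lgt0 _ (pos _ _ xz))
   ?(nmulr_llt0 _ (neg _ _ yz)) ?(pmulr_llt0 _ (pos _ _ yz))
   ?(nmulr_lgt0 _ (neg _ _ yz)) ?(pmulr_lgt0 _ (pos _ _ yz));
  apply/idP/idP; lra.
Qed.

End Circle.

(** * Chords and orientation in the disk *)

Section Disk.
Context {R : realType}.
Implicit Types (a b x y z t : R) (p q r w c : R * R).

Lemma disk_pt x : disk (pt x).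
Proof. by rewrite /disk /= pt_norm. Qed.

Lemma pt_inj a b : circle a -> circle b -> pt a = pt b -> a = b.
Proof.
rewrite /circle /= => ha hb [e1 e2].
have c1 : cos (2 * pi * (b - a)) = 1 :> R.
  by rewrite mulrBr cosB -e1 -e2 -!expr2 cos2Dsin2.
have /eqP : sin (pi * (b - a)) = 0.
  apply/eqP; rewrite -sqrf_eq0; apply/eqP.
  have e : 2 * pi * (b - a) = (pi * (b - a)) *+ 2 by rewrite mulr2n; ring.
  by move: c1; rewrite e cos_mulr2n cos2sin2 -mulr_natl; lra.
by rewrite -sgr_eq0 sgr_sin_pi ?sgr_eq0 ?subr_eq0 => [/eqP->//|]; lra.
Qed.

Lemma pt_surj w : w.1 ^+ 2 + w.2 ^+ 2 = 1 -> exists2 x, circle x & pt x = w.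
Proof.
case: w => u v /= uv; have pi0 := @pi_gt0 R.
have hu : -1 <= u <= 1 by nra.
have cu : cos (acos u) = u by apply: acosK; rewrite in_itv.
have su : sin (acos u) = `|v|.
  by rewrite sin_acos // (_ : 1 - u ^+ 2 = v ^+ 2) ?sqrtr_sqr //; lra.
have /andP[a0 a1] : 0 <= acos u <= pi by rewrite acos_ge0 ?acos_lepi.
have [v0|v0] := leP 0 v.
  exists (acos u / (2 * pi)).
    rewrite /circle /= divr_ge0 ?mulr_ge0 //=; try lra.
    by rewrite ltr_pdivrMr; nra.
  by rewrite /pt mulrC divfK ?cu ?su ?ger0_norm //; nra.
have u1 : acos u != 0.
  by apply/eqP => e; move: su; rewrite e sin0 => /esym/eqP; rewrite normr_eq0; lra.
exists (1 - acos u / (2 * pi)).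
  have : 0 < acos u / (2 * pi) by rewrite divr_gt0 ?lt_neqAle 1?eq_sym ?u1 //; nra.
  have : acos u / (2 * pi) <= 1 by rewrite ler_pdivrMr; nra.
  by rewrite /circle /=; lra.
rewrite -[1 - _](subrK 1) ptD1 addrC addKr /pt mulrN cosN sinN mulrC divfK; last nra.
by rewrite cu su ltr0_norm ?opprK.
Qed.

Definition segment p q t : R * R := (1 - t) *: p + t *: q.

Lemma chord_atE a b t : chord_at a b t = segment (pt a) (pt b) t.
Proof. by []. Qed.

Lemma segment1 p q t : (segment p q t).1 = (1 - t) * p.1 + t * q.1.
Proof. by []. Qed.

Lemma segment2 p q t : (segment p q t).2 = (1 - t) * p.2 + t * q.2.
Proof. by []. Qed.

Lemma segment_p0 p q : segment p q 0 = p.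
Proof. by rewrite /segment subr0 scale1r scale0r addr0. Qed.

Lemma segment_p1 p q : segment p q 1 = q.
Proof. by rewrite /segment subrr scale1r scale0r add0r. Qed.

Lemma segment_const p t : segment p p t = p.
Proof. by rewrite /segment -scalerDl subrK scale1r. Qed.

Lemma pt_dist_gt0 p q : p != q -> 0 < (q.1 - p.1) ^+ 2 + (q.2 - p.2) ^+ 2.
Proof.
move=> pq; rewrite lt_neqAle addr_ge0 ?sqr_ge0 // andbT eq_sym.
apply: contraNneq pq => /eqP; rewrite paddr_eq0 ?sqr_ge0 // !sqrf_eq0 !subr_eq0.
by case: p q => [p1 p2] [q1 q2] /= /andP[/eqP-> /eqP->].
Qed.

Lemma segment_norm p q t : p.1 ^+ 2 + p.2 ^+ 2 = 1 -> q.1 ^+ 2 + q.2 ^+ 2 = 1 ->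
  (segment p q t).1 ^+ 2 + (segment p q t).2 ^+ 2 =
  1 - t * (1 - t) * ((q.1 - p.1) ^+ 2 + (q.2 - p.2) ^+ 2).
Proof.
case: p q => [p1 p2] [q1 q2]; rewrite segment1 segment2 /= => hp hq.
transitivity ((1 - t) * (p1 ^+ 2 + p2 ^+ 2) + t * (q1 ^+ 2 + q2 ^+ 2) -
  t * (1 - t) * ((q1 - p1) ^+ 2 + (q2 - p2) ^+ 2)); first by ring.
by rewrite hp hq; ring.
Qed.

Lemma disk_segment p q t : 0 <= t <= 1 -> disk p -> disk q -> disk (segment p q t).
Proof.
case: p q => [p1 p2] [q1 q2]; rewrite /disk /segment /= => ht hp hq.
have : 0 <= t * (1 - t) * ((q1 - p1) ^+ 2 + (q2 - p2) ^+ 2).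
  by apply: mulr_ge0; [apply: mulr_ge0; lra|rewrite addr_ge0 ?sqr_ge0].
have : (1 - t) * (p1 ^+ 2 + p2 ^+ 2) <= 1 - t by rewrite ler_piMr //; lra.
have : t * (q1 ^+ 2 + q2 ^+ 2) <= t by rewrite ler_piMr //; lra.
rewrite -[X in X <= 1]/(((1 - t) * p1 + t * q1) ^+ 2 + ((1 - t) * p2 + t * q2) ^+ 2).
by nra.
Qed.

Lemma chord_disk a b : chord a b `<=` disk.
Proof.
by move=> _ [t ht <-]; rewrite chord_atE; apply: disk_segment => //; apply: disk_pt.
Qed.

Lemma det3_segment p q r s t :
  det3 p q (segment r s t) = (1 - t) * det3 p q r + t * det3 p q s.
Proof. by rewrite /det3 segment1 segment2; ring. Qed.

Lemma det3_left p q : det3 p q p = 0.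
Proof. by rewrite /det3; ring. Qed.

Lemma det3_right p q : det3 p q q = 0.
Proof. by rewrite /det3; ring. Qed.

Lemma chord_det3 a b w : chord a b w -> det3 (pt a) (pt b) w = 0.
Proof.
by move=> [t _ <-]; rewrite chord_atE det3_segment det3_left det3_right; ring.
Qed.

(** If t is the parameter of w on the line, then
    |w|^2 = 1 - t (1 - t) |q - p|^2, so |w| <= 1 forces 0 <= t <= 1. *)
Lemma disk_line_chord a b w :
  pt a != pt b -> disk w -> det3 (pt a) (pt b) w = 0 -> chord a b w.
Proof.
move=> ab; have D0 := pt_dist_gt0 ab.
have hp := pt_norm a; have hq := pt_norm b.
set p := pt a in D0 hp ab *; set q := pt b in D0 hp hq ab *.
set D := _ + _ in D0.
pose t := ((w.1 - p.1) * (q.1 - p.1) + (w.2 - p.2) * (q.2 - p.2)) / D.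
move=> dw det0.
have Dn : D != 0 by rewrite gt_eqF.
(* By the vanishing of det3, w is its own orthogonal projection on the line. *)
have ws : segment p q t = w.
  have tD : t * D = (w.1 - p.1) * (q.1 - p.1) + (w.2 - p.2) * (q.2 - p.2).
    by rewrite /t divfK.
  rewrite [RHS]surjective_pairing [LHS]surjective_pairing segment1 segment2.
  congr pair; apply: (mulfI Dn).
    transitivity (D * p.1 + (t * D) * (q.1 - p.1)); first by ring.
    rewrite tD; apply/eqP; rewrite -subr_eq0; apply/eqP.
    transitivity (det3 p q w * (q.2 - p.2)); last by rewrite det0 mul0r.
    by rewrite /det3 /D; ring.
  transitivity (D * p.2 + (t * D) * (q.2 - p.2)); first by ring.
  rewrite tD; apply/eqP; rewrite -subr_eq0; apply/eqP.
  transitivity (- det3 p q w * (q.1 - p.1)); last by rewrite det0 oppr0 mul0r.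
  by rewrite /det3 /D; ring.
exists t => //=; move: dw; rewrite /disk /= -ws segment_norm // -/D => h.
have : 0 <= t * (1 - t) by rewrite -(pmulr_lge0 _ D0); lra.
by nra.
Qed.

(** The circle is strictly convex. *)
Lemma chord_circle_end a b t x : pt a != pt b -> 0 <= t <= 1 ->
  chord_at a b t = pt x -> t = 0 \/ t = 1.
Proof.
move=> ab ht e; have := pt_norm x.
rewrite -e chord_atE segment_norm ?pt_norm //.
set D := (_ ^+ 2 + _ ^+ 2) => h.
have D0 : 0 < D by exact: (pt_dist_gt0 ab).
have /eqP : t * (1 - t) * D = 0 by lra.
rewrite !mulf_eq0 (gt_eqF D0) orbF => /orP[/eqP|/eqP]; [left|right]; lra.
Qed.

Lemma det3_rot p q r : det3 p q r = det3 q r p.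
Proof. by rewrite /det3; ring. Qed.

Lemma unit_dot_lt1 p q : p.1 ^+ 2 + p.2 ^+ 2 = 1 -> q.1 ^+ 2 + q.2 ^+ 2 = 1 ->
  p != q -> p.1 * q.1 + p.2 * q.2 < 1.
Proof. by move=> hp hq /pt_dist_gt0; nra. Qed.

Lemma disk_dot_le1 p w : p.1 ^+ 2 + p.2 ^+ 2 = 1 -> disk w ->
  p.1 * w.1 + p.2 * w.2 <= 1.
Proof.
rewrite /disk /= => hp hw.
have := sqr_ge0 (p.1 - w.1); have := sqr_ge0 (p.2 - w.2); nra.
Qed.

(** If det3 c p1 p3 is positive, then p2 - c is a positive combination of
    p1 - c and p3 - c, and the sum of the coefficients exceeds 1 exactly when
    the triangle is positively oriented.  It does exceed 1: the scalar product
    with p2 is at most 1 on the disk, and p1 is not p2. *)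
Lemma ccw_from_center c p1 p2 p3 :
  p1.1 ^+ 2 + p1.2 ^+ 2 = 1 -> p2.1 ^+ 2 + p2.2 ^+ 2 = 1 ->
  p3.1 ^+ 2 + p3.2 ^+ 2 = 1 -> p2.1 * c.1 + p2.2 * c.2 < 1 ->
  0 < det3 c p1 p2 -> 0 < det3 c p2 p3 -> 0 < det3 p1 p2 p3.
Proof.
move=> n1 n2 n3 hc C12 C23.
have -> : det3 p1 p2 p3 = det3 c p1 p2 + det3 c p2 p3 - det3 c p1 p3.
  by rewrite /det3; ring.
have [C13|C13] := leP (det3 c p1 p3) 0; first lra.
have p12 : p2 != p1 by apply: contraTneq C12 => ->; rewrite det3_right ltxx.
have h1 := unit_dot_lt1 n2 n1 p12.
have h3 : p2.1 * p3.1 + p2.2 * p3.2 <= 1 by apply: disk_dot_le1; rewrite // /disk /= n3.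
set k := 1 - (p2.1 * c.1 + p2.2 * c.2).
have k0 : 0 < k by rewrite /k; lra.
have id : det3 c p1 p3 * k =
    det3 c p2 p3 * (p2.1 * p1.1 + p2.2 * p1.2 - (p2.1 * c.1 + p2.2 * c.2)) +
    det3 c p1 p2 * (p2.1 * p3.1 + p2.2 * p3.2 - (p2.1 * c.1 + p2.2 * c.2)).
  by rewrite /k -n2 /det3; ring.
rewrite subr_gt0 -(ltr_pM2r k0) id [ltRHS]mulrDl [ltRHS]addrC.
apply: ltr_leD; first by rewrite ltr_pM2l // /k ltrD2r.
by apply: ler_wpM2l; [exact: ltW|rewrite /k lerD2r].
Qed.

Lemma det3_polar c (r1 r2 th1 th2 : R) :
  det3 c (c + r1 *: pt th1) (c + r2 *: pt th2) =
  r1 * r2 * sin (2 * (pi * (th2 - th1))) :> R.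
Proof. by rewrite /det3 /pt /= !mulrBr sinB !mulrA /GRing.scale /=; ring. Qed.

(** The three gaps between the angles add up to a full turn, so at most one of
    them reaches a half turn and two consecutive ones satisfy the hypotheses of
    [ccw_from_center]. *)
Lemma ccw_from_angles c (r1 r2 r3 th1 th2 th3 : R) p1 p2 p3 :
  0 < r1 -> 0 < r2 -> 0 < r3 ->
  p1 = c + r1 *: pt th1 -> p2 = c + r2 *: pt th2 -> p3 = c + r3 *: pt th3 ->
  p1.1 ^+ 2 + p1.2 ^+ 2 = 1 -> p2.1 ^+ 2 + p2.2 ^+ 2 = 1 ->
  p3.1 ^+ 2 + p3.2 ^+ 2 = 1 ->
  p1.1 * c.1 + p1.2 * c.2 < 1 -> p2.1 * c.1 + p2.2 * c.2 < 1 ->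
  p3.1 * c.1 + p3.2 * c.2 < 1 ->
  th1 < th2 -> th2 < th3 -> th3 < th1 + 1 -> 0 < det3 p1 p2 p3.
Proof.
move=> r10 r20 r30 e1 e2 e3 n1 n2 n3 h1 h2 h3 t12 t23 t31.
have pi0 := @pi_gt0 R.
have pos (r r' th th' : R) : 0 < r -> 0 < r' -> 0 < th' - th < 2^-1 ->
    0 < det3 c (c + r *: pt th) (c + r' *: pt th').
  move=> r0 r'0 h; rewrite det3_polar !mulr_gt0 //.
  by apply: sin_gt0_pi; apply/andP; split; nra.
have C12 : th2 - th1 < 2^-1 -> 0 < det3 c p1 p2.
  by move=> h; rewrite e1 e2; apply: pos => //; lra.
have C23 : th3 - th2 < 2^-1 -> 0 < det3 c p2 p3.
  by move=> h; rewrite e2 e3; apply: pos => //; lra.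
have C31 : th1 + 1 - th3 < 2^-1 -> 0 < det3 c p3 p1.
  by move=> h; rewrite e3 e1 -(ptD1 th1); apply: pos => //; lra.
case: (ltP (th2 - th1) 2^-1) => [/C12 {}C12|g12].
  case: (ltP (th3 - th2) 2^-1) => [/C23 {}C23|g23].
    exact: (ccw_from_center n1 n2 n3 h2).
  rewrite -det3_rot; apply: (ccw_from_center n3 n1 n2 h1) => //.
  by apply: C31; lra.
rewrite det3_rot; apply: (ccw_from_center n2 n3 n1 h3); first by apply: C23; lra.
by apply: C31; lra.
Qed.

End Disk.

(** * Supporting lines and the angle along a curve *)

Section HalfPlanes.
Context {R : realType}.
Implicit Types (t al be ga : R) (p q w c y z : R * R) (A K : set (R * R)).

Definition aff al be ga w : R := al * w.1 + be * w.2 + ga.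

(** For closed K with interior points this amounts to convexity, but it can be
    checked on the boundary curve alone, which is what is known of the image of
    a gap. *)
Definition supported K : Prop := forall y, boundary K y ->
  exists al be ga, [/\ 0 < al ^+ 2 + be ^+ 2,
    forall w, K w -> 0 <= aff al be ga w & aff al be ga y = 0].

Lemma continuous_aff al be ga : continuous (aff al be ga).
Proof.
move=> w; rewrite /aff; apply: cvgD; last exact: cvg_cst.
by apply: cvgD; apply: cvgM; (try exact: cvg_cst); [exact: cvg_fst|exact: cvg_snd].
Qed.

Lemma continuous_segment p q : continuous (segment p q).
Proof.
move=> t; rewrite /segment; apply: cvgD; apply: cvgZr_tmp => //.
  by apply: cvgB => //; exact: cvg_cst.
Qed.

Lemma det3_aff p q w : det3 p q w =
  aff (p.2 - q.2) (q.1 - p.1) ((q.2 - p.2) * p.1 - (q.1 - p.1) * p.2) w.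
Proof. by rewrite /det3 /aff; ring. Qed.

Lemma continuous_det3 p q : continuous (det3 p q).
Proof.
rewrite (_ : det3 p q = aff (p.2 - q.2) (q.1 - p.1)
  ((q.2 - p.2) * p.1 - (q.1 - p.1) * p.2)); first exact: continuous_aff.
by apply/funext => w; apply: det3_aff.
Qed.

Lemma aff_ray al be ga z t :
  aff al be ga (z - t *: (al, be)) = aff al be ga z - t * (al ^+ 2 + be ^+ 2).
Proof. by rewrite /aff /= /GRing.scale /=; ring. Qed.

Lemma continuous_ray z (v : R * R) : continuous (fun t : R => z - t *: v).
Proof.
move=> t; apply: cvgB; first exact: cvg_cst.
by apply: cvgZr_tmp.
Qed.

(** From a zero of the affine function, a small step against its gradient
    would stay in K and make it negative. *)
Lemma interior_aff_gt0 K al be ga c : 0 < al ^+ 2 + be ^+ 2 ->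
  (forall w, K w -> 0 <= aff al be ga w) -> K° c -> 0 < aff al be ga c.
Proof.
move=> n0 sK Kc; rewrite lt_neqAle eq_sym sK ?andbT; last exact: nbhs_singleton.
apply/eqP => c0.
have : \forall t \near 0, K (c - t *: (al, be)).
  apply: (continuous_ray (z := c) (v := (al, be)) (x := 0)).
  by rewrite scale0r subr0.
move=> /nbhs_ballP[e /= e0 eK].
have /eK/sK : ball (0 : R) e (e / 2).
  by rewrite /ball /= sub0r normrN gtr0_norm ?divr_gt0 //; lra.
by rewrite aff_ray c0; nra.
Qed.

Lemma closure_aff_ge0 K al be ga : (forall w, K w -> 0 <= aff al be ga w) ->
  forall w, closure K w -> 0 <= aff al be ga w.
Proof.
move=> sK; have cl : closed (aff al be ga @^-1` [set x | 0 <= x]).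
  apply: closed_comp; last exact: closed_ge.
  by move=> w _; apply: continuous_aff.
by move=> w /(closureS sK); rewrite -(iffLR (closure_id _) cl).
Qed.

Lemma bounded_ray_slope (x a M : R) :
  (forall t, 0 <= t -> `|x - t * a| <= M) -> a = 0.
Proof.
move=> h; apply/eqP/negPn/negP => a0.
have na : 0 < `|a| by rewrite normr_gt0.
have M0 : 0 <= M by apply: le_trans (h 0 _).
have t0 : 0 <= (`|x| + M + 1) / `|a| by rewrite divr_ge0 // !addr_ge0.
have := h _ t0; have := lerB_normD ((`|x| + M + 1) / `|a| * a) (- x).
rewrite normrN -(distrC x) normrM (ger0_norm t0) divfK ?gt_eqF //.
by lra.
Qed.

(** From a point outside the half-plane, the ray against the gradient avoids
    A, so the component of that point is unbounded. *)
Lemma region_bounded_by_aff A al be ga : 0 < al ^+ 2 + be ^+ 2 ->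
  (forall w, A w -> 0 <= aff al be ga w) ->
  forall w, region_bounded_by A w -> 0 <= aff al be ga w.
Proof.
move=> n0 sA w [/sA//|[nAw]]; set C := connected_component _ _ => bC.
rewrite leNgt; apply/negP => w0.
pose ray := (fun t => w - t *: (al, be)) @` [set t | 0 <= t].
have rayC : ray `<=` C.
  apply: connected_component_max.
  - by exists 0 => //=; rewrite scale0r subr0.
  - move=> _ [t /= t0 <-] /sA; rewrite aff_ray; nra.
  - apply: connected_continuous_connected.
      by apply/connected_intervalP => x y /= x0 y0 z /andP[xz _]; apply: le_trans xz.
    by apply: continuous_subspaceT; apply: continuous_ray.
have [M [_ /(_ (M + 1)) hM]] := bC.
have {}hM t : 0 <= t -> `|w - t *: (al, be)| <= M + 1.
  by move=> t0; apply: hM; [rewrite ltrDl|apply: rayC; exists t].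
have al0 : al = 0.
  apply: (@bounded_ray_slope w.1 al (M + 1)) => t /hM.
  by rewrite prod_normE ge_max => /andP[].
have be0 : be = 0.
  apply: (@bounded_ray_slope w.2 be (M + 1)) => t /hM.
  by rewrite prod_normE ge_max => /andP[].
by move: n0; rewrite al0 be0 expr0n addr0 ltxx.
Qed.

Lemma aff_along al be ga c u t :
  aff al be ga (c + t *: u) = aff al be ga c + t * (al * u.1 + be * u.2).
Proof. by rewrite /aff /= /GRing.scale /=; ring. Qed.

(** The supporting line at the nearer of two boundary points on a ray from c
    would separate c from the farther one. *)
Lemma supported_star K c (u : R * R) (r1 r2 : R) : supported K -> K° c ->
  0 < r1 -> 0 < r2 -> boundary K (c + r1 *: u) -> boundary K (c + r2 *: u) ->
  r1 = r2.
Proof.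
move=> sK Kc.
have lt r r' : 0 < r -> boundary K (c + r *: u) -> boundary K (c + r' *: u) -> ~ r < r'.
  move=> r0 b1 [b2 _] rr'; have [al [be [ga [n0 pos y0]]]] := sK _ b1.
  have c0 := interior_aff_gt0 n0 pos Kc.
  have := closure_aff_ge0 pos b2.
  move: y0; rewrite !aff_along; set s := al * _ + _ => h1 h2.
  by nra.
move=> r10 r20 b1 b2; have [l|l|//] := ltgtP r1 r2.
  by case: (lt _ _ r10 b1 b2 l).
by case: (lt _ _ r20 b2 b1 l).
Qed.

Lemma periodic_int (T : Type) (g : R -> T) : (forall t, g (t + 1) = g t) ->
  forall t (k : int), g (t + k%:~R) = g t.
Proof.
move=> per; have pern t (n : nat) : g (t + n%:R) = g t.
  by elim: n => [|n IH]; rewrite ?addr0 // -addn1 natrD addrA per.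
move=> t [n|n]; first exact: pern.
by rewrite NegzE mulrNz -(pern (t - _) n.+1) subrK.
Qed.

Lemma periodic_inj_int (T : Type) (g : R -> T) : (forall t, g (t + 1) = g t) ->
  {in `[0, 1[ &, injective g} ->
  forall s t, g s = g t -> exists k : int, t = s + k%:~R.
Proof.
move=> per inj s t; rewrite -(periodic_int per s (- Num.floor s)).
rewrite -(periodic_int per t (- Num.floor t)) => /inj; rewrite !in_itv /=.
have := frac_itv s; have := frac_itv t; rewrite /Defs.frac !mulrNz => ht hs.
move=> /(_ hs ht) e; exists (Num.floor t - Num.floor s).
by rewrite intrD mulrNz; lra.
Qed.

(** By [supported_star] equal angles modulo 1 give equal points, so the
    continuous function theta is injective, hence monotone; it increases by 1 in
    each period. *)
Lemma angle_increasing K g : supported K -> positive_parametrization K g ->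
  exists c (r theta : R -> R), [/\ K° c, forall t, 0 < r t,
    forall t, g t = c + r t *: pt (theta t),
    forall t, theta (t + 1) = theta t + 1 &
    forall s t, s < t -> theta s < theta t].
Proof.
move=> sK [_ per inj bd [c [r [theta [Kc ct pt1 pol]]]]].
exists c, r, theta; split=> //; [by move=> t; case: (pol t)|by move=> t; case: (pol t)|].
have gB t : boundary K (g t) by rewrite -bd; exists t.
have thk t (k : int) : theta (t + k%:~R) - (t + k%:~R) = theta t - t.
  apply: (@periodic_int _ (fun t => theta t - t)) => s.
  by rewrite pt1; lra.
have thI : injective theta.
  move=> s t e.
  have gst : g s = g t.
    have [rs es] := pol s; have [rt et] := pol t.
    rewrite es et -e; congr (_ + _ *: _).
    apply: (supported_star sK Kc rs rt (u := pt (theta s))).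
      by rewrite -es.
    by rewrite e -et.
  have [k tk] := periodic_inj_int per inj gst.
  by have := thk s k; rewrite -tk -e; lra.
have mono : {in `]-oo, +oo[%R &, {mono theta : x y / x <= y}}.
  apply: itv_continuous_inj_le.
  - exists 0, 1; split=> //; rewrite ?in_itv //= -[1]add0r pt1; lra.
  - exact: continuous_subspaceT.
  - by move=> x y _ _; apply: thI.
move=> s t st; rewrite lt_neqAle mono ?in_itv // ltW // andbT.
by rewrite (inj_eq thI) lt_eqF.
Qed.

End HalfPlanes.

(** * Chords contained in a Jordan curve *)

Section JordanChord.
Context {R : realType}.
Implicit Types (s t a b : R) (K : set (R * R)) (g : R -> R * R).

Lemma connected_unit : connected [set t : R | 0 <= t <= 1].
Proof.
apply/connected_intervalP => x y /= /andP[x0 _] /andP[_ y1] z /andP[xz zy].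
by rewrite (le_trans x0 xz) (le_trans zy y1).
Qed.

Lemma connected_chord a b : connected (chord a b).
Proof.
apply: connected_continuous_connected; first exact: connected_unit.
apply: continuous_subspaceT; exact: (@continuous_segment R (pt a) (pt b)).
Qed.

Lemma connected_not_separated (T : topologicalType) (C A1 A2 : set T) :
  connected C -> closed A1 -> closed A2 -> C `<=` A1 `|` A2 ->
  C `&` A1 !=set0 -> C `&` A2 !=set0 -> exists x : T, [/\ C x, A1 x & A2 x].
Proof.
move=> cC c1 c2 cov n1 [y [Cy A2y]]; apply: contrapT => nex.
have : C `&` A1 = C.
  apply: cC => //; last by exists A1.
  exists (~` A2); first exact: closed_openC.
  apply/seteqP; split=> x [Cx Ax]; split=> //.
    by move=> A2x; apply: nex; exists x.
  by case: (cov x Cx).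
move=> /esym e; have : C y := Cy; rewrite e => -[_ A1y].
by apply: nex; exists y.
Qed.

Lemma closed_arc g s t : continuous g -> closed (g @` `[s, t]).
Proof.
move=> cg; apply: compact_closed; first exact: norm_hausdorff.
apply: continuous_compact; first exact: continuous_subspaceT.
exact: segment_compact.
Qed.

(** If the curve has points on both sides of the line of the chord, then both
    arcs between two such points meet the chord.  These arcs cover the chord by
    two closed sets that meet only at the endpoints of the arcs, which are off
    the line; this contradicts the connectedness of the chord. *)
Lemma chord_no_crossing K g a b s1 s2 :
  continuous g -> (forall t, g (t + 1) = g t) -> {in `[0, 1[ &, injective g} ->
  range g = boundary K -> boundary K `<=` disk -> pt a != pt b ->
  chord a b `<=` boundary K -> s1 < s2 < s1 + 1 ->
  det3 (pt a) (pt b) (g s1) * det3 (pt a) (pt b) (g s2) < 0 -> False.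
Proof.
move=> cg per inj rg bdisk ab chB /andP[s12 s21] sgn.
set h := det3 (pt a) (pt b) in sgn.
have ch : continuous (h \o g).
  by move=> t; apply: continuous_comp; [exact: cg|exact: continuous_det3].
have zero s t : s <= t -> h (g s) * h (g t) < 0 -> exists2 m, s <= m <= t & h (g m) = 0.
  move=> st hst; have [m mi e] : exists2 m, m \in `[s, t] & (h \o g) m = 0.
    apply: IVT => //; first exact: continuous_subspaceT.
    by rewrite ge_min le_max /=; case: (leP (h (g s)) 0) => h0; apply/andP; split; nra.
  by exists m => //; move: mi; rewrite in_itv.
have bg t : boundary K (g t) by rewrite -rg; exists t.
have onchord m : h (g m) = 0 -> chord a b (g m).
  by move=> e; apply: disk_line_chord => //; apply: bdisk.
(* The two arcs from s1 to s2 and from s2 to s1 + 1 meet the line at m1, m2. *)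
have [m1 m1i e1] := zero s1 s2 (ltW s12) sgn.
have [m2 m2i e2] : exists2 m, s2 <= m <= s1 + 1 & h (g m) = 0.
  by apply: zero; rewrite ?per 1?mulrC // ltW.
have [x [xC [u ui ux] [v vi vx]]] : exists x,
    [/\ chord a b x, (g @` `[s1, s2]) x & (g @` `[s2, s1 + 1]) x].
  apply: connected_not_separated; try exact: closed_arc.
  - exact: connected_chord.
  - move=> x /chB; rewrite -rg => -[t _ <-].
    pose k := Num.floor (t - s1); have := floor_itv (t - s1); rewrite intrD -/k => hk.
    have gt : g (t - k%:~R) = g t by rewrite -mulrNz periodic_int.
    case: (leP (t - k%:~R) s2) => ht; [left|right]; exists (t - k%:~R) => //=;
      rewrite in_itv /=; lra.
  - by exists (g m1); split; [exact: onchord|exists m1; rewrite //= in_itv].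
  - by exists (g m2); split; [exact: onchord|exists m2; rewrite //= in_itv].
have hx : h x = 0 by apply: chord_det3.
have [k vk] : exists k : int, v = u + k%:~R by apply: (periodic_inj_int per inj); rewrite ux vx.
move: ui vi; rewrite /= !in_itv /= => ui vi.
(* The two arcs have length less than 1, so u and v can only be a shared end. *)
have : (0 <= k <= 1)%R.
  by apply/andP; split; rewrite -(ler_int R); lra.
have k01 : (0 <= k <= 1)%R -> k = 0 \/ k = 1 by lia.
move=> /k01[] ke.
  have us : u = s2 by rewrite ke in vk; lra.
  by move: sgn; rewrite -us ux hx mulr0 ltxx.
have us : u = s1 by rewrite ke in vk; lra.
by move: sgn; rewrite -us ux hx mul0r ltxx.
Qed.

(** By [chord_no_crossing] the curve does not visit both open sides of the
    line; the sign e accounts for the orientation of the chord. *)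
Lemma chord_one_side K g a b :
  continuous g -> (forall t, g (t + 1) = g t) -> {in `[0, 1[ &, injective g} ->
  range g = boundary K -> boundary K `<=` disk -> pt a != pt b ->
  chord a b `<=` boundary K ->
  exists2 e : R, e ^+ 2 = 1 &
    forall y, boundary K y -> 0 <= e * det3 (pt a) (pt b) y.
Proof.
move=> cg per inj rg bdisk ab chB; set h := det3 (pt a) (pt b).
have same s t : h (g s) * h (g t) < 0 -> False.
  pose s' := s - (Num.floor s)%:~R; pose t' := t - (Num.floor t)%:~R.
  have -> : g s = g s' by rewrite /s' -mulrNz periodic_int.
  have -> : g t = g t' by rewrite /t' -mulrNz periodic_int.
  have := frac_itv s; have := frac_itv t; rewrite /Defs.frac -/s' -/t' => ht hs.
  have [lt|lt|->] := ltgtP s' t'.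
  - by apply: (chord_no_crossing (s1 := s') (s2 := t') cg per inj rg) => //; lra.
  - by rewrite mulrC; apply: (chord_no_crossing (s1 := t') (s2 := s') cg per inj rg) => //; lra.
  - by rewrite -expr2 ltNge sqr_ge0.
case: (pselect (exists s, h (g s) < 0)) => [[s hs]|nex].
  exists (-1); first by rewrite sqrrN expr1n.
  move=> y; rewrite -rg => -[t _ <-]; rewrite mulN1r oppr_ge0 leNgt.
  by apply/negP => ht; apply: (same s t); rewrite nmulr_rlt0.
exists 1; first by rewrite expr1n.
move=> y; rewrite -rg => -[t _ <-]; rewrite mul1r leNgt.
by apply/negP => ht; apply: nex; exists t.
Qed.

End JordanChord.

(** * Gaps as intersections of half-planes *)

Section Gap.
Context {R : realType}.
Implicit Types (a b x t : R) (p q w y z : R * R) (L : set (R * R)) (A : set (R * R)).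

Definition segment_convex A : Prop :=
  forall p q t, A p -> A q -> 0 <= t <= 1 -> A (segment p q t).

Lemma segment_convexP A : segment_convex A <-> convex_set A.
Proof.
split=> [h p q l | h p q t Ap Aq /andP[t0 t1]].
  rewrite !inE => Ap Aq; have := h q p l%:num Aq Ap.
  by rewrite /segment addrC; apply; rewrite ge0 le1.
have := h q p (Itv01 t0 t1); rewrite !inE => /(_ Aq Ap).
by rewrite /conv /= /segment addrC.
Qed.

Lemma pt_neq a b : circle a -> circle b -> (pt a != pt b) = (a != b).
Proof.
move=> ha hb; congr negb; apply/eqP/eqP => [|->//]; exact: pt_inj.
Qed.

Lemma chord_refl a w : chord a a w -> w = pt a.
Proof. by move=> [t _ <-]; rewrite chord_atE segment_const. Qed.

Lemma chord_left a b : chord a b (pt a).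
Proof. by exists 0; rewrite /= ?lexx ?ler01 // chord_atE segment_p0. Qed.

Lemma connected_segment p q : connected (segment p q @` [set t | 0 <= t <= 1]).
Proof.
apply: connected_continuous_connected; first exact: connected_unit.
by apply: continuous_subspaceT; exact: continuous_segment.
Qed.

Lemma connected_same_sign A (h : R * R -> R) p q : connected A -> continuous h ->
  (forall w, A w -> h w != 0) -> A p -> A q -> 0 < h p * h q.
Proof.
move=> cA ch h0 Ap Aq; rewrite ltNge; apply/negP => hpq.
have : connected (h @` A).
  by apply: connected_continuous_connected => //; apply: continuous_subspaceT.
move=> /connected_intervalP itv.
have [w Aw /eqP] : (h @` A) 0.
  have hp : (h @` A) (h p) by exists p.
  have hq : (h @` A) (h q) by exists q.
  have [hp0|hp0] := leP (h p) 0.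
    by apply: (itv _ _ hp hq); have := h0 _ Ap; nra.
  by apply: (itv _ _ hq hp); nra.
by rewrite (negPf (h0 _ Aw)).
Qed.

(** The set of leaves, with their endpoints, is compact, and the union is a
    continuous image of its product with [0, 1]. *)
Lemma lamination_union_closed L : lamination L -> closed (lamination_union L).
Proof.
case=> _ _ _ clL _.
set E := [set (pt p.1, pt p.2) | p in L] in clL.
pose S := `[-1, 1]%classic `*` `[-1, 1]%classic : set (R * R).
have cS : compact S by apply: compact_setX; exact: segment_compact.
have ptS x : S (pt x).
  by split; rewrite /= in_itv /= ?cos_geN1 ?cos_le1 ?sin_geN1 ?sin_le1.
have cE : compact E.
  apply: (subclosed_compact clL (compact_setX cS cS)).
  by move=> _ [p _ <-]; split; apply: ptS.
pose phi (u : (R * R) * (R * R) * R) := segment u.1.1 u.1.2 u.2.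
have cphi : continuous phi.
  have cfst (T1 T2 : topologicalType) : continuous (@fst T1 T2).
    by move=> v; exact: cvg_fst.
  have csnd (T1 T2 : topologicalType) : continuous (@snd T1 T2).
    by move=> v; exact: cvg_snd.
  move=> u; rewrite /phi /segment; apply: cvgD; apply: cvgZ.
  - by apply: cvgB; [exact: cvg_cst|exact: cvg_snd].
  - exact: (continuous_comp (cfst _ _ u) (cfst _ _ _)).
  - exact: cvg_snd.
  - exact: (continuous_comp (cfst _ _ u) (csnd _ _ _)).
have -> : lamination_union L = phi @` (E `*` `[0, 1]%classic).
  apply/seteqP; split=> w.
    move=> [p Lp [t t01 <-]]; exists ((pt p.1, pt p.2), t) => //.
    by split; [exists p|rewrite /= in_itv].
  move=> [[e t] [/= [p Lp <-] t01] <-]; by exists p => //; exists t.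
apply: compact_closed; first exact: norm_hausdorff.
apply: continuous_compact; first exact: continuous_subspaceT.
by apply: compact_setX => //; exact: segment_compact.
Qed.

Section OneGap.
Variables (L : set (R * R)) (z : R * R).
Hypotheses (lamL : lamination L) (zO : (disk `\` lamination_union L) z).
Let O := disk `\` lamination_union L.
Let U := connected_component O z.
Let G := closure U.

Let L_circle a b : L (a, b) -> circle a /\ circle b.
Proof. by case: lamL => h _ _ _ _; apply: h. Qed.

Let O_open_disk w : O w -> w.1 ^+ 2 + w.2 ^+ 2 < 1.
Proof.
move=> [dw nL]; rewrite lt_neqAle [X in _ && X]dw andbT; apply/eqP => e.
have [x xc xw] := pt_surj e; apply: nL; exists (x, x) => /=.
  by case: lamL => _ _ h _ _; apply: h.
by rewrite -xw; apply: chord_left.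
Qed.

Let O_off_leaf a b w : L (a, b) -> pt a != pt b -> O w ->
  det3 (pt a) (pt b) w != 0.
Proof.
move=> Lab ab [dw nL]; apply/eqP => e; apply: nL; exists (a, b) => //=.
exact: disk_line_chord.
Qed.

(** The component is connected and, inside the disk, the line of a leaf is the
    leaf itself, which the component avoids. *)
Lemma component_same_side a b w : L (a, b) -> pt a != pt b -> U w ->
  0 < det3 (pt a) (pt b) z * det3 (pt a) (pt b) w.
Proof.
move=> Lab ab [C [Cz CO cC] Cw].
apply: (connected_same_sign (A := C)) => //; first exact: continuous_det3.
by move=> v /CO; apply: O_off_leaf.
Qed.

(** The segment from z to such a point crosses no leaf. *)
Lemma component_of_sides w : w.1 ^+ 2 + w.2 ^+ 2 < 1 ->
  (forall a b, L (a, b) -> pt a != pt b ->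
    0 < det3 (pt a) (pt b) z * det3 (pt a) (pt b) w) -> U w.
Proof.
move=> dw sw.
exists (segment z w @` [set t | 0 <= t <= 1]); last first.
  by exists 1; rewrite /= ?ler01 ?lexx // segment_p1.
split; [|move=> _ [t /= t01 <-]|exact: connected_segment].
  by exists 0; rewrite /= ?ler01 ?lexx // segment_p0.
have zd := O_open_disk zO.
have sd : (segment z w t).1 ^+ 2 + (segment z w t).2 ^+ 2 < 1.
  rewrite segment1 segment2.
  have : 0 <= t * (1 - t) * ((w.1 - z.1) ^+ 2 + (w.2 - z.2) ^+ 2).
    by apply: mulr_ge0; [apply: mulr_ge0; lra|rewrite addr_ge0 ?sqr_ge0].
  set m := Num.max (z.1 ^+ 2 + z.2 ^+ 2) (w.1 ^+ 2 + w.2 ^+ 2).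
  have m1 : m < 1 by rewrite gt_max zd dw.
  have : (1 - t) * (z.1 ^+ 2 + z.2 ^+ 2) <= (1 - t) * m.
    by apply: ler_wpM2l; [lra|rewrite le_max lexx].
  have : t * (w.1 ^+ 2 + w.2 ^+ 2) <= t * m.
    by apply: ler_wpM2l; [lra|rewrite le_max lexx orbT].
  by nra.
split; first exact: ltW.
move=> [[a b] Lab /= ch].
have [e|ab] := eqVneq (pt a) (pt b).
  move: ch sd => [t' _ <-]; rewrite chord_atE -e segment_const pt_norm ltxx //.
have := chord_det3 ch; rewrite det3_segment => e.
have h1 := sw a b Lab ab.
have := O_off_leaf Lab ab zO; set dz := det3 _ _ z in e h1 *.
set dw' := det3 _ _ w in e h1 => dz0.
have : 0 < dz ^+ 2 by rewrite exprn_even_gt0.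
have : dz * ((1 - t) * dz + t * dw') = 0 by rewrite e mulr0.
have -> : dz * ((1 - t) * dz + t * dw') = (1 - t) * dz ^+ 2 + t * (dz * dw') by ring.
by case: (leP t (1 / 2)) => ht; nra.
Qed.

(** A point that is weakly on the correct side of all leaves is the limit of
    the points of the segment from z to it, which are strictly on that side. *)
Lemma gapP w : G w <-> disk w /\ forall a b, L (a, b) -> pt a != pt b ->
  0 <= det3 (pt a) (pt b) z * det3 (pt a) (pt b) w.
Proof.
have sub a b v : det3 (pt a) (pt b) z * det3 (pt a) (pt b) v =
    aff (det3 (pt a) (pt b) z * ((pt a).2 - (pt b).2))
        (det3 (pt a) (pt b) z * ((pt b).1 - (pt a).1))
        (det3 (pt a) (pt b) z * (((pt b).2 - (pt a).2) * (pt a).1 -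
                                 ((pt b).1 - (pt a).1) * (pt a).2)) v.
  by rewrite [in LHS](det3_aff _ _ v) /aff; ring.
split=> [Gw|[dw sw]].
  split; last first.
    move=> a b Lab ab; rewrite sub; apply: (closure_aff_ge0 _ Gw) => v Uv.
    by rewrite -sub ltW // component_same_side.
  (* The bound (|w|^2 + 1) / 2 lies between |w|^2 and the scalar products of
     w with points of the disk. *)
  rewrite /disk /= leNgt; apply/negP => w1.
  have dist : 0 < w.1 ^+ 2 + w.2 ^+ 2 by lra.
  have := closure_aff_ge0 (al := - w.1) (be := - w.2)
    (ga := (w.1 ^+ 2 + w.2 ^+ 2 + 1) / 2) (K := U) _ Gw.
  rewrite /aff => h; suff : 0 <= - w.1 * w.1 + - w.2 * w.2 + (w.1 ^+ 2 + w.2 ^+ 2 + 1) / 2.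
    by nra.
  apply: h => v Uv; have := O_open_disk (connected_component_sub Uv).
  have := sqr_ge0 (w.1 - v.1); have := sqr_ge0 (w.2 - v.2); nra.
move=> B wB.
have : \forall t \near (1 : R), B (segment z w t).
  by apply: (continuous_segment (p := z) (q := w) (x := 1)); rewrite segment_p1.
move=> /nbhs_ballP[e /= e0 eB].
(* Both bounds matter: 1 - s stays in the ball and in the unit interval. *)
pose s := Num.min (e / 2) (1 / 2).
have s0 : 0 < s by rewrite lt_min; apply/andP; split; lra.
have s1 : s <= 1 / 2 by rewrite ge_min lexx orbT.
have se : s <= e / 2 by rewrite ge_min lexx.
exists (segment z w (1 - s)); split; last first.
  by apply: eB; rewrite /ball /= subKr gtr0_norm //; lra.
apply: component_of_sides.
  have zd := O_open_disk zO; rewrite segment1 segment2 subKr.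
  move: dw; rewrite /disk /= => dw.
  have : 0 <= s * (1 - s) * ((w.1 - z.1) ^+ 2 + (w.2 - z.2) ^+ 2).
    by apply: mulr_ge0; [apply: mulr_ge0; lra|rewrite addr_ge0 ?sqr_ge0].
  have : s * (z.1 ^+ 2 + z.2 ^+ 2) < s by rewrite gtr_pMr.
  have : (1 - s) * (w.1 ^+ 2 + w.2 ^+ 2) <= 1 - s by rewrite ger_pMr //; lra.
  by nra.
move=> a b Lab ab; rewrite det3_segment subKr mulrDr.
have := sw a b Lab ab; set dz := det3 _ _ z; set dw' := det3 _ _ w => h.
apply: ltr_wpDr; first by rewrite mulrCA mulr_ge0 //; lra.
rewrite mulrCA mulr_gt0 // -expr2 exprn_even_gt0 //=.
exact: O_off_leaf.
Qed.

Lemma gap_segment_convex : segment_convex G.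
Proof.
move=> p q t /gapP[dp sp] /gapP[dq sq] t01; apply/gapP; split.
  exact: disk_segment.
move=> a b Lab ab; rewrite det3_segment mulrDr addr_ge0 // mulrCA mulr_ge0 //; try lra.
- exact: sp.
- exact: sq.
Qed.

End OneGap.
End Gap.

(** * The boundary of a gap *)

Section GapBoundary.
Context {R : realType}.
Implicit Types (a b x t : R) (p q w y : R * R).
Variables (L : set (R * R)) (z : R * R).
Hypotheses (lamL : lamination L) (zO : (disk `\` lamination_union L) z).
Let O := disk `\` lamination_union L.
Let U := connected_component O z.
Let G := closure U.

Lemma gap_disk : G `<=` disk.
Proof. by move=> w /(gapP lamL zO)[]. Qed.

Lemma gap_closed : closure G = G.
Proof. by apply/esym/closure_id; apply: closed_closure. Qed.

Lemma unit_aff x w : 1 - ((pt x).1 * w.1 + (pt x).2 * w.2) =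
  aff (- (pt x).1) (- (pt x).2) 1 w.
Proof. by rewrite /aff; ring. Qed.

Lemma disk_aff x w : disk w -> 0 <= aff (- (pt x).1) (- (pt x).2) 1 w.
Proof.
by move=> dw; rewrite -unit_aff subr_ge0; apply: disk_dot_le1 dw; apply: pt_norm.
Qed.

Lemma unit_aff_pt x : aff (- (pt x).1) (- (pt x).2) 1 (pt x) = 0.
Proof. by rewrite -unit_aff -!expr2 pt_norm subrr. Qed.

Lemma disk_interior (K : set (R * R)) x c : K `<=` disk -> K° c ->
  (pt x).1 * c.1 + (pt x).2 * c.2 < 1.
Proof.
move=> KD Kc; rewrite -subr_gt0 unit_aff; apply: (interior_aff_gt0 _ _ Kc).
  by rewrite !sqrrN pt_norm.
by move=> w /KD; apply: disk_aff.
Qed.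

Lemma boundary_circle (K : set (R * R)) x : K `<=` disk -> K (pt x) ->
  boundary K (pt x).
Proof.
move=> KD Kx; split; first exact: subset_closure.
by move=> /(disk_interior x KD); rewrite -!expr2 pt_norm ltxx.
Qed.

Lemma gap_circle_chord x : circle x -> G (pt x) -> boundary_chord L G x x.
Proof.
move=> xc Gx; split; first by case: lamL => _ _ h _ _; apply: h.
by move=> w /chord_refl ->; apply: boundary_circle => //; exact: gap_disk.
Qed.

Let leaf_aff a b : exists ga, forall w,
  det3 (pt a) (pt b) z * det3 (pt a) (pt b) w =
  aff (det3 (pt a) (pt b) z * ((pt a).2 - (pt b).2))
      (det3 (pt a) (pt b) z * ((pt b).1 - (pt a).1)) ga w.
Proof.
exists (det3 (pt a) (pt b) z *
  (((pt b).2 - (pt a).2) * (pt a).1 - ((pt b).1 - (pt a).1) * (pt a).2)) => w.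
by rewrite [in LHS](det3_aff _ _ w) /aff; ring.
Qed.

Let z_off_leaf a b : L (a, b) -> pt a != pt b -> det3 (pt a) (pt b) z != 0.
Proof.
move=> Lab ab; have [dz nL] := zO; apply/eqP => e; apply: nL.
by exists (a, b) => //=; exact: disk_line_chord.
Qed.

Let leaf_slope a b : L (a, b) -> pt a != pt b ->
  0 < (det3 (pt a) (pt b) z * ((pt a).2 - (pt b).2)) ^+ 2 +
      (det3 (pt a) (pt b) z * ((pt b).1 - (pt a).1)) ^+ 2.
Proof.
move=> Lab ab; rewrite !exprMn -mulrDr mulr_gt0 //.
  by rewrite exprn_even_gt0 //= z_off_leaf.
by have := pt_dist_gt0 ab; nra.
Qed.

(** Another leaf does not cross chord a b, so its defining function does not
    take opposite signs at a and b; it is nonnegative at one point strictly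
    between them, hence all along the chord. *)
Lemma leaf_in_gap a b t : L (a, b) -> pt a != pt b -> 0 < t < 1 ->
  G (chord_at a b t) -> chord a b `<=` G.
Proof.
move=> Lab ab t01 /(gapP lamL zO)[_ st] w cw; apply/(gapP lamL zO).
split; first exact: chord_disk cw.
move=> a' b' Lab' ab'; have := st a' b' Lab' ab'.
case: cw => s s01 <-; rewrite !chord_atE !det3_segment.
set dz := det3 _ _ z; set da := det3 _ _ (pt a); set db := det3 _ _ (pt b).
have dz0 : dz != 0 by apply: z_off_leaf.
have nocross : 0 <= (dz * da) * (dz * db).
  rewrite (_ : _ * _ = dz ^+ 2 * (da * db)); last by ring.
  rewrite mulr_ge0 ?sqr_ge0 // leNgt; apply/negP => opp.
  (* The crossing point would be common to two leaves without being an end. *)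
  pose u := da / (da - db).
  have dab : da - db != 0 
    by rewrite subr_eq0; apply: contraTneq opp => ->; rewrite -leNgt -expr2 sqr_ge0.
  have ue : u * (da - db) = da by rewrite /u divfK.
  have u01 : 0 < u < 1.
    have D2 : 0 < (da - db) ^+ 2 by rewrite exprn_even_gt0.
    have uD : u * (da - db) ^+ 2 = da * (da - db) by rewrite expr2 mulrA ue.
    apply/andP; split; first by rewrite -(pmulr_lgt0 u D2) uD; nra.
    by rewrite -(ltr_pM2r D2) uD mul1r; nra.
  have onl : det3 (pt a') (pt b') (segment (pt a) (pt b) u) = 0.
    by rewrite det3_segment -/da -/db; lra.
  have cab : chord a b (segment (pt a) (pt b) u) by exists u => //=; lra.
  have cab' : chord a' b' (segment (pt a) (pt b) u).
    by apply: disk_line_chord => //; apply: chord_disk cab.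
  have chN : chord a b <> chord a' b'.
    move=> e; have := chord_left a b; rewrite e => /chord_det3; rewrite -/da => da0.
    by move: opp; rewrite da0 mul0r ltxx.
  have [_ _ _ _ nc] := lamL.
  have [ends _] := nc _ _ _ _ Lab Lab' chN _ (conj cab cab').
  case: ends => e; rewrite e in onl.
    by move: opp; rewrite /da onl mul0r ltxx.
  by move: opp; rewrite /db onl mulr0 ltxx.
have distr (r : R) : dz * ((1 - r) * da + r * db) = (1 - r) * (dz * da) + r * (dz * db).
  by ring.
rewrite !distr; set A := dz * da in nocross *; set B := dz * db in nocross *.
move: s01 => /= s01 h.
have pos (x y : R) : 0 <= x -> 0 <= y -> 0 <= (1 - s) * x + s * y.
  by move=> x0 y0; rewrite addr_ge0 // mulr_ge0 //; lra.
have [A0|A0] := leP 0 A; have [B0|B0] := leP 0 B; first exact: pos.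
- have A00 : A = 0.
    apply/eqP; rewrite eq_le A0 andbT leNgt; apply/negP => A1.
    by move: nocross; rewrite nmulr_lge0 // leNgt A1.
  have : t * B < 0 by rewrite nmulr_llt0 //; lra.
  by rewrite A00 in h *; lra.
- have B00 : B = 0.
    apply/eqP; rewrite eq_le B0 andbT leNgt; apply/negP => B1.
    by move: nocross; rewrite pmulr_lge0 // leNgt A0.
  have : (1 - t) * A < 0 by rewrite nmulr_llt0 //; lra.
  by rewrite B00 in h *; lra.
have : t * B < 0 by rewrite nmulr_llt0 //; lra.
have : (1 - t) * A < 0 by rewrite nmulr_llt0 //; lra.
by lra.
Qed.

(** A point of the gap off all leaves has a ball around it that avoids the
    leaves and meets the component, so it is interior. *)
Lemma gap_boundary_chord y : boundary G y ->
  exists a b, boundary_chord L G a b /\ chord a b y.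
Proof.
move=> [Gy nIy]; rewrite gap_closed in Gy.
have [[[a b] Lab /= cy]|nL] := pselect (lamination_union L y); last first.
  exfalso; apply: nIy; rewrite /interior /=.
  have dy := gap_disk Gy.
  have y1 : y.1 ^+ 2 + y.2 ^+ 2 < 1.
    rewrite lt_neqAle [X in _ && X]dy andbT; apply/eqP => e.
    have [x xc xy] := pt_surj e; apply: nL; exists (x, x) => /=.
      by case: lamL => _ _ h _ _; apply: h.
    by rewrite -xy; apply: chord_left.
  have : nbhs y ([set w : R * R | w.1 ^+ 2 + w.2 ^+ 2 < 1] `&` ~` lamination_union L).
    apply: filterI.
      have cn : continuous (fun w : R * R => w.1 ^+ 2 + w.2 ^+ 2).
        move=> w; apply: cvgD; rewrite /exprz; apply: cvgM; first exact: cvg_fst.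
        - exact: cvg_fst.
        - exact: cvg_snd.
        - exact: cvg_snd.
      exact: (cn y _ (lt_nbhsl y1)).
    apply: open_nbhs_nbhs; split => //; apply: closed_openC.
    exact: lamination_union_closed.
  move=> /nbhs_ballP[e /= e0 eO].
  have [u [Uu yu]] := Gy _ (nbhsx_ballx y e e0).
  apply/nbhs_ballP; exists e => //= w yw; apply: subset_closure.
  apply: (connected_component_trans (y := u)) => //.
  exists (segment u w @` [set t | 0 <= t <= 1]); last first.
    by exists 1; rewrite /= ?ler01 ?lexx // segment_p1.
  split; [|move=> _ [t /= t01 <-]|exact: connected_segment].
    by exists 0; rewrite /= ?ler01 ?lexx // segment_p0.
  have [d nLw] : ([set w : R * R | w.1 ^+ 2 + w.2 ^+ 2 < 1] `&` ~` lamination_union L) (segment u w t).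
    apply: eO; move: yu yw; rewrite -!ball_normE /ball_ /= => yu yw.
    have -> : y - segment u w t = (1 - t) *: (y - u) + t *: (y - w).
      rewrite /segment !scalerBr addrACA -scalerDl subrK scale1r.
      by rewrite -opprD.
    apply: le_lt_trans (ler_normD _ _) _; rewrite !normrZ.
    rewrite !ger0_norm; try lra.
    set m := Num.max `|y - u| `|y - w|.
    have me : m < e by rewrite gt_max yu.
    have : (1 - t) * `|y - u| <= (1 - t) * m by apply: ler_wpM2l; [lra|rewrite le_max lexx].
    have : t * `|y - w| <= t * m by apply: ler_wpM2l; [lra|rewrite le_max lexx orbT].
    by lra.
  by split; [apply: ltW|].
have [ca cb] : circle a /\ circle b by case: lamL => h _ _ _ _; apply: h.
have [e|ab] := eqVneq (pt a) (pt b).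
  have ya : y = pt a by case: cy => t _ <-; rewrite chord_atE -e segment_const.
  exists a, a; split; last by rewrite ya; apply: chord_left.
  by apply: gap_circle_chord => //; rewrite -ya.
have [t t01 ty] := cy.
have [t0|t0] := eqVneq t 0.
  have ya : y = pt a by rewrite -ty t0 chord_atE segment_p0.
  exists a, a; split; last by rewrite ya; apply: chord_left.
  by apply: gap_circle_chord => //; rewrite -ya.
have [t1|t1] := eqVneq t 1.
  have ya : y = pt b by rewrite -ty t1 chord_atE segment_p1.
  exists b, b; split; last by rewrite ya; apply: chord_left.
  by apply: gap_circle_chord => //; rewrite -ya.
have tt : 0 < t < 1 by move: t01 => /= /andP[? ?]; rewrite !lt_neqAle eq_sym t0 t1; lra.
exists a, b; split=> //; split=> // w cw.
have Gw : G w by apply: (leaf_in_gap Lab ab tt); rewrite ?ty.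
split; first exact: subset_closure.
have [ga E] := leaf_aff a b.
move=> Iw; have := interior_aff_gt0 (ga := ga) (leaf_slope Lab ab) _ Iw.
rewrite -E (chord_det3 cw) mulr0 ltxx => h; suff : false by [].
apply: h => v Gv; rewrite -E.
by have [_ /(_ a b Lab ab)] := iffLR (gapP lamL zO v) Gv.
Qed.

Lemma gap_supported : supported G.
Proof.
move=> y /gap_boundary_chord[a [b [[Lab sub] cy]]].
have [e|ab] := eqVneq (pt a) (pt b).
  have -> : y = pt a by case: cy => t _ <-; rewrite chord_atE -e segment_const.
  exists (- (pt a).1), (- (pt a).2), 1; split; last exact: unit_aff_pt.
    by rewrite !sqrrN pt_norm.
  by move=> w /gap_disk; apply: disk_aff.
have [ga E] := leaf_aff a b.
exists (det3 (pt a) (pt b) z * ((pt a).2 - (pt b).2)).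
exists (det3 (pt a) (pt b) z * ((pt b).1 - (pt a).1)), ga.
split; first exact: (leaf_slope Lab ab).
  by move=> v /(gapP lamL zO)[_ /(_ a b Lab ab)]; rewrite E.
by rewrite -E (chord_det3 cy) mulr0.
Qed.

End GapBoundary.

(** * The image of a gap *)

Section Coverings.
Context {R : realType}.
Implicit Types (A B : set (R * R)) (f : R * R -> R * R).

Lemma covering_fibre i A B f y : covering_map i A B f -> B y ->
  exists phi : 'I_i -> R * R, [/\ injective phi, forall k, A (phi k),
    forall k, f (phi k) = y & forall x, A x -> f x = y -> exists k, x = phi k].
Proof.
move=> [_ fAB cov] By; have [V [U [_ Vy _ disj [pre homeo]]]] := cov y By.
have /choice[phi phiP] : forall k, exists x, (A `&` U k) x /\ f x = y.
  move=> k; have [_ im _] := homeo k.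
  have : (B `&` V) y by [].
  by rewrite -im => -[x Ax fx]; exists x.
exists phi; split=> [k l e|k|k|x Ax fx].
- apply: disj => //; exists (phi k); split; first by case: (phiP k).
  by rewrite e; case: (phiP l).
- by case: (phiP k) => -[].
- by case: (phiP k).
have : (A `&` f @^-1` V) x by split=> //=; rewrite fx.
rewrite pre => -[k _ xk]; exists k.
have [_ _ [g [_ gK]]] := homeo k.
by have [pk fk] := phiP k; rewrite -(gK x xk) -(gK _ pk) fx fk.
Qed.

End Coverings.

Section GapImage.
Context {R : realType}.
Implicit Types (a b x t : R) (p q w y : R * R).
Variables (d : nat) (L : set (R * R)) (z : R * R).
Hypotheses (lamL : lamination L) (zO : (disk `\` lamination_union L) z).
Let G := closure (connected_component (disk `\` lamination_union L) z).
Let A := [set w | exists a b,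
    boundary_chord L G a b /\ chord (sigma d a) (sigma d b) w].
Let K := gap_image d L G.

(** The disk is the intersection of the half-planes of its tangent lines. *)
Lemma gap_image_disk : K `<=` disk.
Proof.
move=> w Kw; rewrite /disk /= leNgt; apply/negP => w1.
pose n := Num.sqrt (w.1 ^+ 2 + w.2 ^+ 2).
have n2 : n ^+ 2 = w.1 ^+ 2 + w.2 ^+ 2 by rewrite sqr_sqrtr //; lra.
have n0 : 0 <= n by apply: sqrtr_ge0.
have n1 : 1 < n by nra.
have nn : n != 0 by rewrite gt_eqF //; lra.
have [x _ xw] : exists2 x, circle x & pt x = (w.1 / n, w.2 / n).
  by apply: pt_surj; rewrite /= !expr_div_n -mulrDl -n2 divff // sqrf_eq0.
have : 0 <= aff (- (pt x).1) (- (pt x).2) 1 w.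
  apply: (region_bounded_by_aff _ _ Kw); first by rewrite !sqrrN pt_norm.
  by move=> v [a [b [_ /chord_disk dv]]]; apply: disk_aff.
rewrite -unit_aff xw /=.
have -> : w.1 / n * w.1 + w.2 / n * w.2 = n.
  by apply: (mulIf nn); rewrite mulrDl -expr2 n2; field.
by lra.
Qed.

Variables (i : nat) (f : R * R -> R * R).
Hypotheses (actf : boundary_action d L G f)
  (covf : covering_map i (boundary G) (boundary K) f).

Let action_chord a b t : boundary_chord L G a b -> 0 <= t <= 1 ->
  boundary G (chord_at a b t) /\ f (chord_at a b t) = chord_at (sigma d a) (sigma d b) t.
Proof.
by move=> bc t01; split; [case: bc => _; apply; exists t|apply: actf].
Qed.

(** Every boundary point of the gap lies on a boundary chord, so the action on
    these chords determines all of the image curve. *)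
Lemma image_chord_boundary : A = boundary K.
Proof.
have [_ im _] := covf; rewrite -im; apply/seteqP; split=> w.
  move=> [a [b [bc [t t01 <-]]]]; exists (chord_at a b t); first exact: (action_chord bc t01).1.
  exact: (action_chord bc t01).2.
move=> [u /(gap_boundary_chord lamL zO)[a [b [bc [t t01 <-]]]] <-].
exists a, b; split=> //; exists t => //; by rewrite (action_chord bc t01).2.
Qed.

Lemma gap_image_supported g : positive_parametrization K g -> supported K.
Proof.
move=> [cg per inj rg _] y; rewrite -image_chord_boundary => -[a [b [bc cy]]].
have chA : chord (sigma d a) (sigma d b) `<=` boundary K.
  by rewrite -image_chord_boundary => w cw; exists a, b.
have [e|ab] := eqVneq (pt (sigma d a)) (pt (sigma d b)).
  have -> : y = pt (sigma d a) by case: cy => t _ <-; rewrite chord_atE -e segment_const.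
  exists (- (pt (sigma d a)).1), (- (pt (sigma d a)).2), 1; split; last exact: unit_aff_pt.
    by rewrite !sqrrN pt_norm.
  by move=> w /gap_image_disk; apply: disk_aff.
have bK : boundary K `<=` disk.
  by rewrite -image_chord_boundary => w [a' [b' [_ /chord_disk]]].
have [e e2 side] := chord_one_side cg per inj rg bK ab chA.
set p := pt (sigma d a) in ab side *; set q := pt (sigma d b) in ab side *.
have E w : e * det3 p q w = aff (e * (p.2 - q.2)) (e * (q.1 - p.1))
    (e * ((q.2 - p.2) * p.1 - (q.1 - p.1) * p.2)) w.
  by rewrite [in LHS](det3_aff _ _ w) /aff; ring.
have n0 : 0 < (e * (p.2 - q.2)) ^+ 2 + (e * (q.1 - p.1)) ^+ 2.
  by rewrite !exprMn e2 !mul1r; have := pt_dist_gt0 ab; nra.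
exists (e * (p.2 - q.2)), (e * (q.1 - p.1)),
  (e * ((q.2 - p.2) * p.1 - (q.1 - p.1) * p.2)).
split; [exact: n0| |by rewrite -E (chord_det3 cy) mulr0].
apply: region_bounded_by_aff => // w.
by rewrite -/A image_chord_boundary -E; apply: side.
Qed.

Lemma action_circle x : circle x -> G (pt x) ->
  boundary G (pt x) /\ f (pt x) = pt (sigma d x).
Proof.
move=> xc Gx; have bc := gap_circle_chord lamL zO xc Gx.
have h0 : 0 <= (0 : R) <= 1 by rewrite lexx ler01.
by have := action_chord bc h0; rewrite !chord_atE !segment_p0.
Qed.

Let L_circle a b : L (a, b) -> circle a /\ circle b.
Proof. by case: lamL => h _ _ _ _; apply: h. Qed.

(** A collapsed leaf would be an infinite set inside a fibre of i points. *)
Lemma leaf_not_collapsed a b : boundary_chord L G a b -> a != b ->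
  sigma d a != sigma d b.
Proof.
move=> bc ab; apply/eqP => e.
have [ca cb] := L_circle bc.1.
have ptab : pt a != pt b by rewrite pt_neq.
(* One point more than a fibre can hold. *)
pose tt (j : 'I_i.+1) : R := j%:R / i.+1%:R.
have i0 : 0 < i.+1%:R :> R by rewrite ltr0n.
have tt01 j : 0 <= tt j <= 1.
  rewrite /tt divr_ge0 ?ler0n //= ler_pdivrMr // mul1r ler_nat.
  by rewrite ltnW.
pose y := pt (sigma d a).
have fy j : f (chord_at a b (tt j)) = y.
  by rewrite (action_chord bc (tt01 j)).2 -e chord_atE segment_const.
have By : boundary K y.
  by have [_ <- _] := covf; exists (chord_at a b (tt ord0)) => //; apply: (action_chord bc (tt01 _)).1.
have [phi [_ _ _ sur]] := covering_fibre covf By.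
have /choice[h hP] : forall j, exists k, chord_at a b (tt j) = phi k.
  by move=> j; apply: sur => //; apply: (action_chord bc (tt01 _)).1.
have : injective h.
  move=> j k ejk; have : chord_at a b (tt j) = chord_at a b (tt k) by rewrite !hP ejk.
  rewrite !chord_atE => seg.
  have D := pt_dist_gt0 ptab.
  have s1 := congr1 fst seg; have s2 := congr1 snd seg.
  rewrite !segment1 in s1; rewrite !segment2 in s2.
  have : (tt j - tt k) * (((pt b).1 - (pt a).1) ^+ 2 + ((pt b).2 - (pt a).2) ^+ 2) = 0.
    have e1 : (tt j - tt k) * ((pt b).1 - (pt a).1) = 0 by lra.
    have e2 : (tt j - tt k) * ((pt b).2 - (pt a).2) = 0 by lra.
    by rewrite mulrDr !expr2 !mulrA e1 e2 !mul0r addr0.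
  move/eqP; rewrite mulf_eq0 (gt_eqF D) orbF subr_eq0 /tt => /eqP.
  by move/(mulIf (invr_neq0 (lt0r_neq0 i0)))/eqP; rewrite eqr_nat => /eqP/val_inj.
by move/leq_card; rewrite !card_ord ltnn.
Qed.

(** A point strictly inside a leaf maps strictly inside a nondegenerate chord,
    hence not to the circle. *)
Lemma vertex_fibre u (p : R) : boundary G u -> circle p -> f u = pt p ->
  exists x, [/\ circle x, u = pt x, G (pt x) & sigma d x = p].
Proof.
move=> Bu cp fu; have [a [b [bc [t t01 tu]]]] := gap_boundary_chord lamL zO Bu.
have [ca cb] := L_circle bc.1.
have Gu : G u by move: Bu => [+ _]; rewrite /G (gap_closed L z).
have fin x : circle x -> u = pt x ->
    exists x, [/\ circle x, u = pt x, G (pt x) & sigma d x = p].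
  move=> cx ux; exists x; split=> //; first by rewrite -ux.
  rewrite ux in Gu fu; have := (action_circle cx Gu).2; rewrite fu.
  by move/esym/pt_inj; apply => //; apply: circle_sigma.
have [ab|ab] := eqVneq a b.
  by apply: (fin a) => //; rewrite -tu -ab chord_atE segment_const.
have sab := leaf_not_collapsed bc ab.
have : chord_at (sigma d a) (sigma d b) t = pt p.
  by rewrite -(action_chord bc t01).2 tu.
move/chord_circle_end => /(_ _ t01)[|t0|t1].
- by rewrite pt_neq //; apply: circle_sigma.
- by apply: (fin a) => //; rewrite -tu t0 chord_atE segment_p0.
- by apply: (fin b) => //; rewrite -tu t1 chord_atE segment_p1.
Qed.

End GapImage.

(** * Cyclic order of the preimages of the vertices *)

Section Enumeration.
Context {R : realType}.
Implicit Types (P : {fset R}).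

(** Distinctness is required separately because the condition on triples is
    empty for N <= 2. *)
Definition cyclic_enum (N : nat) (xs : nat -> R) : Prop :=
  (forall j k, (j < N)%N -> (k < N)%N -> xs j = xs k -> j = k) /\
  (forall j k l, (j < k)%N -> (k < l)%N -> (l < N)%N -> ccw (xs j) (xs k) (xs l)).

(** Seen from the interior point c the angle increases by less than a full
    turn along the parameters s 0, ..., s (N - 1), so [ccw_from_angles]
    applies. *)
Lemma cyclic_enum_param (K : set (R * R)) g N xs (s : nat -> R) :
  K `<=` disk -> supported K -> positive_parametrization K g ->
  (forall k, (k < N)%N -> circle (xs k) /\ g (s k) = pt (xs k)) ->
  (forall j k, (j < k)%N -> (k < N)%N -> s j < s k /\ s k < s j + 1) ->
  cyclic_enum N xs.
Proof.
move=> KD sK gK xsP sP; have [_ per inj _ _] := gK.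
have [c [r [th [Kc r0 gE th1 thS]]]] := angle_increasing sK gK.
split.
  have neq j k : (j < k)%N -> (k < N)%N -> xs j != xs k.
    move=> jk kN; apply/eqP => e.
    have [s1 s2] := sP _ _ jk kN.
    have [m /eqP] : exists m : int, s k = s j + m%:~R.
      apply: (periodic_inj_int per inj).
      by rewrite (xsP _ kN).2 (xsP _ (ltn_trans jk kN)).2 e.
    rewrite addrC -subr_eq => /eqP me.
    have : (0 < m)%R by rewrite -(ltr_int R); lra.
    have : (m < 1)%R by rewrite -(ltr_int R); lra.
    by lia.
  move=> j k jN kN e; have [jk|kj|//] := ltngtP j k.
    by move: (neq _ _ jk kN); rewrite e eqxx.
  by move: (neq _ _ kj jN); rewrite e eqxx.
move=> j k l jk kl lN.
have kN := ltn_trans kl lN; have jN := ltn_trans jk kN.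
have [cj ej] := xsP _ jN; have [ck ek] := xsP _ kN; have [cl el] := xsP _ lN.
rewrite -det3_gt0 //.
have [s1 _] := sP _ _ jk kN; have [s2 _] := sP _ _ kl lN.
have [_ s3] := sP _ _ (ltn_trans jk kl) lN.
apply: (@ccw_from_angles R c (r (s j)) (r (s k)) (r (s l)) (th (s j)) (th (s k)) (th (s l)));
  rewrite -?ej -?ek -?el ?gE //; rewrite -?gE ?ej ?ek ?el ?pt_norm //.
- exact: disk_interior Kc.
- exact: disk_interior Kc.
- exact: disk_interior Kc.
- exact: thS.
- exact: thS.
- by rewrite -th1; exact: thS.
Qed.

(** In a period starting at F 0, let s j be the parameters of the vertices of
    P on Bd(K).  The translates s j + q with q < F 1 - F 0 are exactly the
    values of F on [0, 1[ at preimages of vertices; as F is increasing, the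
    preimages inherit their order. *)
Lemma portrait_vertices (d : nat) (L G : set (R * R)) (i n : nat) P :
  lamination L -> round_gap L G -> gap_degree d L G i ->
  (0 < n)%N -> polygon P -> #|` P| = n -> hull P `<=` gap_image d L G ->
  exists xs ps : nat -> R, [/\
    cyclic_enum (n * i) xs, cyclic_enum n ps,
    forall p, (p \in P) <-> exists2 j, (j < n)%N & p = ps j,
    forall k, (k < n * i)%N -> [/\ circle (xs k), G (pt (xs k)) &
      sigma d (xs k) = ps (k %% n)%N] &
    forall x, circle x -> G (pt x) -> sigma d x \in P ->
      exists2 k, (k < n * i)%N & x = xs k].
Proof.
move=> lamL [[z [zO ->]] _]; set G0 := closure _.
move=> [f [actf covf [g [g' [F [gG gK cF Fmono fgF]]]]]] n0 [Pc _] Pn PK.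
set K := gap_image d L G0 in covf gK PK.
have KD : K `<=` disk by exact: gap_image_disk.
have sK : supported K by apply: (gap_image_supported lamL zO actf covf gK).
have sG : supported G0 by apply: gap_supported.
have GD : G0 `<=` disk by apply: gap_disk.
have [_ per inj rg _] := gG; have [_ per' inj' rg' _] := gK.
have Plift p : p \in P -> exists s, F 0 <= s < F 0 + 1 /\ g' s = pt p.
  move=> pP.
  have : boundary K (pt p).
    apply: boundary_circle => //; apply: PK => C [_]; apply.
    by exists p.
  rewrite -rg' => -[s _ gs].
  exists (s - (Num.floor (s - F 0))%:~R); split.
    by have := floor_itv (s - F 0); rewrite intrD; lra.
  by rewrite -mulrNz periodic_int.
have /choice[S SP] : forall p, exists s, p \in P -> F 0 <= s < F 0 + 1 /\ g' s = pt p.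
  by move=> p; case: (boolP (p \in P)) => [/Plift[s]|_]; [exists s|exists 0].
have Sinj : {in P &, injective S}.
  move=> p q pP qP e; apply: pt_inj; [exact: Pc|exact: Pc|].
  by rewrite -(SP p pP).2 -(SP q qP).2 e.
pose le_S p q := S p <= S q.
(* The vertices of P in the order in which g' visits them from F 0 on. *)
pose pl := sort le_S P.
have plP p : (p \in pl) = (p \in P) by rewrite mem_sort.
have plu : uniq pl by rewrite sort_uniq.
have pls : size pl = n by rewrite size_sort.
have pls' : sorted le_S pl by apply: sort_sorted => p q; apply: le_total.
pose ps j := nth 0 pl j.
have psP j : (j < n)%N -> ps j \in P by move=> jn; rewrite -plP mem_nth ?pls.
pose s j := S (ps j).
have s_lt j k : (j < k)%N -> (k < n)%N -> s j < s k.
  move=> jk kn; have jn := ltn_trans jk kn.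
  rewrite lt_neqAle; apply/andP; split.
    apply: contraTneq jk => /Sinj e; have /eqP := e (psP _ jn) (psP _ kn).
    by rewrite nth_uniq ?pls // => /eqP->; rewrite ltnn.
  apply: (sorted_ltn_nth (leT := le_S)) => //; rewrite ?inE ?pls //.
  by move=> y x w; apply: le_trans.
have sI j : (j < n)%N -> F 0 <= s j < F 0 + 1 /\ g' (s j) = pt (ps j).
  by move=> jn; apply: SP; apply: psP.
(* The k-th parameter at which g', run repeatedly, visits a vertex of P. *)
pose sx k := s (k %% n)%N + (k %/ n)%N%:R.
have mod_lt k : (k %% n < n)%N by rewrite ltn_mod.
have sx_lt j k : (j < k)%N -> sx j < sx k.
  move=> jk; rewrite /sx; have := leq_div2r n (ltnW jk).
  rewrite leq_eqVlt => /orP[/eqP e|lt].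
    rewrite e ltrD2r; apply: s_lt => //.
    by move: jk; rewrite {1}(divn_eq j n) {1}(divn_eq k n) e ltn_add2l.
  have h1 := (sI _ (mod_lt j)).1; have h2 := (sI _ (mod_lt k)).1.
  have : (j %/ n)%N%:R + 1 <= (k %/ n)%N%:R :> R by rewrite natr1 ler_nat.
  by lra.
have g'sx k : g' (sx k) = pt (ps (k %% n)%N).
  by rewrite /sx (_ : _%:R = (k %/ n)%N%:Z%:~R) // periodic_int // (sI _ (mod_lt k)).2.
(* The lift F advances by a whole number of turns in each period. *)
have [m Fm] : exists m : nat, F 1 = F 0 + m%:R.
  have [k Fk] : exists k : int, F 1 = F 0 + k%:~R.
    by apply: (periodic_inj_int per' inj'); rewrite -!fgF -(per 0) add0r.
  have : F 0 < F 1 by apply: Fmono; lra.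
  by case: k Fk => k -> //; [exists k|rewrite NegzE mulrNz]; have := ler0n R k.+1; lra.
have sx_lt_m k : (k < n * m)%N -> F 0 <= sx k < F 0 + m%:R.
  move=> knm; have h := (sI _ (mod_lt k)).1.
  have : (k %/ n)%N%:R + 1 <= m%:R :> R by rewrite natr1 ler_nat ltn_divLR // mulnC.
  by have := ler0n R (k %/ n); rewrite /sx; lra.
have Finj t t' : F t = F t' -> t = t'.
  move=> e; have [lt|lt|//] := ltgtP t t'; have := Fmono _ _ lt; rewrite e ltxx //.
have /choice[tk tkP] : forall k, exists t, (k < n * m)%N -> 0 <= t < 1 /\ F t = sx k.
  move=> k; case: (ltnP k (n * m)) => [knm|_]; last by exists 0.
  have h := sx_lt_m k knm.
  have [t ti e] : exists2 t, t \in `[0, 1] & F t = sx k.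
    apply: IVT; [lra|exact: continuous_subspaceT|].
    by rewrite Fm ge_min le_max; apply/andP; split; apply/orP; [left|right]; lra.
  exists t => _; split=> //; move: ti; rewrite in_itv /= => /andP[-> t1] /=.
  rewrite lt_neqAle t1 andbT; apply: contraTneq h => t1'.
  by rewrite -e t1' Fm; lra.
have tk_lt j k : (j < k)%N -> (k < n * m)%N -> tk j < tk k.
  move=> jk knm; have jnm := ltn_trans jk knm.
  rewrite ltNge le_eqVlt; apply/negP => /orP[/eqP e|/Fmono].
    by have := sx_lt _ _ jk; rewrite -(tkP _ jnm).2 -(tkP _ knm).2 e ltxx.
  rewrite (tkP _ jnm).2 (tkP _ knm).2 => lt.
  by have := lt_trans lt (sx_lt _ _ jk); rewrite ltxx.
have Bg t : boundary G0 (g t) by rewrite -rg; exists t.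
have ps_circle j : (j < n)%N -> circle (ps j) by move=> jn; apply/Pc/psP.
have /choice[xs xsP] : forall k, exists x, (k < n * m)%N ->
    [/\ circle x, g (tk k) = pt x, G0 (pt x) & sigma d x = ps (k %% n)%N].
  move=> k; case: (ltnP k (n * m)) => [knm|_]; last by exists 0.
  have : f (g (tk k)) = pt (ps (k %% n)%N) by rewrite fgF (tkP k knm).2.
  move/(vertex_fibre lamL zO actf covf (Bg _) (ps_circle _ (mod_lt k))) => [x hx].
  by exists x.
have onto x : circle x -> G0 (pt x) -> sigma d x \in P ->
    exists2 k, (k < n * m)%N & x = xs k.
  move=> xc Gx sxP; have [Bx fx] := action_circle lamL zO actf xc Gx.
  have [t [t01 gt]] : exists t, 0 <= t < 1 /\ g t = pt x.
    move: Bx; rewrite -rg => -[t _ gt]; exists (Defs.frac t); split; first exact: frac_itv.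
    by rewrite /Defs.frac -mulrNz periodic_int.
  have [j jn pj] : exists2 j, (j < n)%N & sigma d x = ps j.
    exists (index (sigma d x) pl); first by rewrite -pls index_mem plP.
    by rewrite /ps nth_index // plP.
  have [k Fk] : exists k : int, F t = s j + k%:~R.
    by apply: (periodic_inj_int per' inj'); rewrite (sI j jn).2 -fgF gt fx pj.
  have F0t : F 0 <= F t.
    have [->|t0] := eqVneq t 0; first by [].
    by apply/ltW/Fmono; rewrite lt_neqAle eq_sym t0; lra.
  have Ft1 : F t < F 0 + m%:R by rewrite -Fm; apply: Fmono; lra.
  have hs := (sI j jn).1.
  have k0 : (0 <= k)%R.
    by rewrite -ltzD1 -(ltr_int R) intrD; lra.
  case: k k0 Fk => // k _ Fk.
  have km : (k < m)%N.
    by rewrite -(ltr_nat R); move: Fk; rewrite -[k%:~R]/(k%:R); lra.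
  have kk : (k * n + j < n * m)%N by nia.
  exists (k * n + j)%N => //.
  have [xk1 xk2 _ _] := xsP _ kk; apply: pt_inj => //; rewrite -xk2 -gt.
  congr g; apply: Finj; rewrite Fk (tkP _ kk).2 /sx modnMDl modn_small //.
  by rewrite divnMDl // divn_small // addn0.
have cyc : cyclic_enum (n * m) xs.
  apply: (@cyclic_enum_param G0 g _ _ tk) => // [k knm|j k jk knm].
    by have [] := xsP k knm.
  split; first exact: tk_lt.
  have := (tkP k knm).1; have := (tkP j (ltn_trans jk knm)).1; lra.
have cycp : cyclic_enum n ps.
  apply: (@cyclic_enum_param K g' _ _ s) => // [k kn|j k jk kn].
    by split; [exact: ps_circle|have [] := sI k kn].
  split; first exact: s_lt.
  by have := (sI k kn).1; have := (sI j (ltn_trans jk kn)).1; lra.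
(* Both m and i count the preimages of the vertex ps 0. *)
have mi : m = i.
  pose y0 := pt (ps 0%N).
  have By0 : boundary K y0.
    by rewrite -rg'; exists (s 0%N) => //; exact: (sI 0%N n0).2.
  have [phi [phiI phiB phif phis]] := covering_fibre covf By0.
  have low (j : 'I_m) : (n * j < n * m)%N by rewrite ltn_pmul2l.
  apply/eqP; rewrite eqn_leq; apply/andP; split.
    have /choice[h hP] : forall j : 'I_m, exists k, g (tk (n * j)%N) = phi k.
      move=> j; apply: phis; first exact: Bg.
      by rewrite fgF (tkP _ (low j)).2 g'sx modnMr.
    have : injective h.
      move=> j j' e; have : g (tk (n * j)%N) = g (tk (n * j')%N) by rewrite !hP e.
      have [cj -> _ _] := xsP _ (low j); have [cj' -> _ _] := xsP _ (low j').
      move/(pt_inj cj cj')/(cyc.1 _ _ (low j) (low j'))/eqP.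
      by rewrite eqn_pmul2l // => /eqP/val_inj.
    by move/leq_card; rewrite !card_ord.
  have /choice[h hP] : forall k : 'I_i, exists j : 'I_m, phi k = pt (xs (n * j)%N).
    move=> k; have [x [cx px Gx sx0]] :=
      vertex_fibre lamL zO actf covf (phiB k) (ps_circle _ n0) (phif k).
    have [|l lnm xl] := onto x cx Gx; first by rewrite sx0; apply: psP.
    have [_ _ _ sxl] := xsP l lnm.
    have l0 : (l %% n = 0)%N.
      by apply: (cycp.1 _ _ (mod_lt l) n0); rewrite -sxl -xl.
    have lm : (l %/ n < m)%N by rewrite ltn_divLR // mulnC.
    exists (Ordinal lm) => /=; rewrite px xl; congr (pt (xs _)).
    by rewrite {1}(divn_eq l n) l0 addn0 mulnC.
  have : injective h by move=> k k' e; apply: phiI; rewrite !hP e.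
  by move/leq_card; rewrite !card_ord.
rewrite -mi; exists xs, ps; split=> //.
- move=> p; split=> [pP|[j jn ->]]; last exact: psP.
  exists (index p pl); first by rewrite -pls index_mem plP.
  by rewrite /ps nth_index // plP.
- by move=> k knm; have [] := xsP k knm.
Qed.

End Enumeration.

(** * Inscribed polygons and crossings *)

Section Hulls.
Context {R : realType}.
Implicit Types (V W : {fset R}) (a b c e : R).

Lemma hull_sub (C : set (R * R)) V : segment_convex C ->
  (forall v, v \in V -> C (pt v)) -> hull V `<=` C.
Proof.
move=> /segment_convexP cC VC w; apply; split=> // _ [v vV <-].
exact: VC.
Qed.

Lemma pt_hull V v : v \in V -> hull V (pt v).
Proof. by move=> vV C [_]; apply; exists v. Qed.

Lemma chord_hull V a b : a \in V -> b \in V -> chord a b `<=` hull V.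
Proof.
move=> aV bV _ [t t01 <-] C [/segment_convexP cC VC]; apply: cC => //; apply: VC.
  by exists a.
by exists b.
Qed.

Lemma det3_swap (p q r : R * R) : det3 p q r = - det3 p r q.
Proof. by rewrite /det3; ring. Qed.

(** The points b and e lie on opposite sides of the line through a and c, so
    the chord from b to e meets that line, inside the disk. *)
Lemma crossing_hulls V W a b c e : polygon V -> polygon W ->
  a \in V -> c \in V -> b \in W -> e \in W -> ccw a b c -> ccw a c e ->
  hull V `&` hull W !=set0.
Proof.
move=> [cV _] [cW _] aV cV' bW eW abc ace.
have [ca cc cb ce] := And4 (cV _ aV) (cV _ cV') (cW _ bW) (cW _ eW).
have db : det3 (pt a) (pt c) (pt b) < 0.
  by rewrite det3_swap oppr_lt0 det3_gt0.
have de : 0 < det3 (pt a) (pt c) (pt e) by rewrite det3_gt0.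
set x := det3 _ _ _ in db; set y := det3 _ _ _ in de.
pose u := - x / (y - x).
have yx : 0 < y - x by lra.
have uyx : u * (y - x) = - x by rewrite /u divfK // gt_eqF.
have u01 : 0 <= u <= 1.
  by rewrite -(pmulr_lge0 u yx) -(ler_pM2r yx u) uyx mul1r; apply/andP; split; lra.
exists (chord_at b e u); split; last by apply: (chord_hull bW eW); exists u.
apply: (chord_hull aV cV'); apply: disk_line_chord.
- by rewrite pt_neq //; have [] := ccw_neq abc.
- by apply: (@chord_disk _ b e); exists u.
- by rewrite chord_atE det3_segment -/x -/y; lra.
Qed.

(** The line through a and c separates the two polygons, strictly on the side
    of W. *)
Lemma separated_hulls V W a c : polygon V -> polygon W -> a \in V -> c \in V ->
  (forall v, v \in V -> ~~ ccw a v c) -> (forall w, w \in W -> ccw a w c) ->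
  hull V `&` hull W = set0.
Proof.
move=> [cV _] [cW _] aV cV' hV hW; rewrite -subset0 => w [].
have /= H1 : hull V `<=` [set w | 0 <= det3 (pt a) (pt c) w].
  apply: hull_sub => [p q t /= p0 q0 t01|v vV /=].
    by rewrite det3_segment addr_ge0 // mulr_ge0 //; lra.
  by rewrite det3_swap oppr_ge0 leNgt det3_gt0 ?hV //; apply: cV.
have /= H2 : hull W `<=` [set w | det3 (pt a) (pt c) w < 0].
  apply: hull_sub => [p q t /= p0 q0 t01|v vV /=].
    rewrite det3_segment; have [->|t1] := eqVneq t 1.
      by rewrite subrr mul0r add0r mul1r.
    have t1' : 0 < 1 - t by rewrite subr_gt0 lt_neqAle t1; lra.
    have : (1 - t) * det3 (pt a) (pt c) p < 0 by rewrite pmulr_rlt0.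
    have : t * det3 (pt a) (pt c) q <= 0 by apply: mulr_ge0_le0; [lra|exact: ltW].
    by lra.
  by rewrite det3_swap oppr_lt0 det3_gt0 ?hW //; [apply: cV|apply: cW|apply: cV].
by move=> /H1 /= h1 /H2 /=; lra.
Qed.

End Hulls.

(** * Residues in a noncrossing partition *)

Section CyclicIndices.
Context {R : realType}.

Definition cyc (j k l : nat) : bool :=
  [|| (j < k < l)%N, (k < l < j)%N | (l < j < k)%N].

Lemma ccw_cyc N (xs : nat -> R) j k l : cyclic_enum N xs ->
  (j < N)%N -> (k < N)%N -> (l < N)%N -> ccw (xs j) (xs k) (xs l) = cyc j k l.
Proof.
move=> [inj cw] jN kN lN.
have pos j' k' l' : (j' < N)%N -> (k' < N)%N -> (l' < N)%N ->
    cyc j' k' l' -> ccw (xs j') (xs k') (xs l').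
  move=> jN' kN' lN' /or3P[]/andP[h1 h2]; first exact: cw.
    by rewrite ccw_rot; apply: cw.
  by rewrite -ccw_rot; apply: cw.
apply/idP/idP => [h|]; last exact: pos.
have [n1 n2 n3] := ccw_neq h.
apply: contraLR h => ncyc; rewrite ccwC //; apply: pos => //.
have jk : j != k by apply: contraNneq n1 => ->.
have kl : k != l by apply: contraNneq n2 => ->.
have jl : j != l by apply: contraNneq n3 => ->.
by move: ncyc jk kl jl; rewrite /cyc; lia.
Qed.

Lemma cyc_modn n j r1 r2 : (0 < r1)%N -> (0 < r2)%N -> (r1 + r2 < n)%N ->
  cyc (j %% n) ((j + r1) %% n) ((j + r1 + r2) %% n).
Proof.
move=> r10 r20 rn; have n0 : (0 < n)%N by lia.
rewrite -(modnDml j r1) -addnA -(modnDml j (r1 + r2)).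
have := ltn_pmod j n0; set x := (j %% n)%N => xn.
have red r : (r < n)%N -> ((x + r) %% n = if (x + r < n)%N then x + r else x + r - n)%N.
  move=> rn'; case: ltnP => h; first by rewrite modn_small.
  by rewrite -{1}(subnK h) modnDr modn_small; lia.
rewrite (red r1) ?(red (r1 + r2)%N); try lia.
by case: (ltnP (x + r1)) => h1; case: (ltnP (x + (r1 + r2))) => h2; rewrite /cyc; lia.
Qed.

(** By [block_gap] the residue of a point of a block grows with its rank in
    the block, and the n ranks stay within one turn. *)
Lemma block_residues_cyc N n i pi (B : {set 'I_N}) (j k l : 'I_N) :
  noncrossing_family n N i pi -> finset.cover pi = finset.setTfor 'I_N ->
  B \in pi -> j \in B -> k \in B -> l \in B -> cyc j k l ->
  cyc (j %% n) (k %% n) (l %% n).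
Proof.
move=> h full Bpi.
have inc j' k' l' : j' \in B -> k' \in B -> l' \in B -> (j' < k')%N -> (k' < l')%N ->
    cyc (j' %% n) (k' %% n) (l' %% n).
  move=> jB kB lB jk kl.
  have [q1 e1] := block_gap h full Bpi jB kB (ltnW jk).
  have [q2 e2] := block_gap h full Bpi kB lB (ltnW kl).
  set r1 := #|_| in e1; set r2 := #|_| in e2.
  have r10 : (0 < r1)%N by apply/card_gt0P; exists j'; rewrite inE jB leqnn.
  have r20 : (0 < r2)%N by apply/card_gt0P; exists k'; rewrite inE kB leqnn.
  have rn : (r1 + r2 < n)%N.
    have [_ sz _ _ _] := h; have [<- _] := sz _ Bpi.
    rewrite (cardsD1 l') lB add1n ltnS.
    have -> : (r1 + r2 = #|finset.setU [set x in B | j' <= x < k'] [set x in B | k' <= x < l']|)%N.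
      rewrite cardsU (_ : finset.setI _ _ = finset.set0) ?cards0 ?subn0 //.
      by apply/finset.setP => x; rewrite !inE; lia.
    apply: subset_leq_card; apply/fintype.subsetP => x; rewrite !inE.
    case/orP => /and3P[-> h1 h2]; rewrite andbT; apply/eqP => xl; rewrite xl in h1 h2; lia.
  have md a q : ((a + q * n) %% n = a %% n)%N by rewrite addnC modnMDl.
  rewrite e2 md e1 md (addnAC _ (q1 * n)%N) md; exact: cyc_modn.
move=> jB kB lB /or3P[]/andP[h1 h2].
- exact: inc.
- by have := inc _ _ _ kB lB jB h1 h2; rewrite /cyc; lia.
- by have := inc _ _ _ lB jB kB h1 h2; rewrite /cyc; lia.
Qed.

End CyclicIndices.

(** * Portraits are noncrossing partitions *)

Lemma card_imfset_finset (T : finType) (K : choiceType) (h : T -> K) (B : {set T}) :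
  {in B &, injective h} -> #|` [fset h x | x in B]%fset| = #|B|.
Proof. by move=> hI; rewrite card_in_imfset // cardE. Qed.

Lemma mem_sides (R : realType) (V : {fset R}) (a b : R) : (a, b) \in sides V =
  [&& a \in V, b \in V, a != b & all (fun x => ~~ in_arc a b x) V].
Proof. by rewrite /sides !inE /= -!andbA. Qed.

Lemma mem_sides_over (R : realType) d (V : {fset R}) s (e : R * R) :
  e \in sides_over d V s = (e \in sides V) && ((sigma d e.1, sigma d e.2) == s).
Proof. by rewrite /sides_over !inE. Qed.

(** Both endpoints of such a side are determined by their images. *)
Lemma sides_over_le1 (R : realType) d (V : {fset R}) s :
  {in V &, injective (sigma d)} -> (#|` sides_over d V s| <= 1)%N.
Proof.
move=> inj; have [->|[e eS]] := fset_0Vmem (sides_over d V s); first by rewrite cardfs0.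
rewrite -(cardfs1 e); apply: fsubset_leq_card; apply/fsubsetP => e' e'S.
rewrite in_fset1; apply/eqP; move: eS e'S.
rewrite (mem_sides_over d V s e) (mem_sides_over d V s e').
case: e e' => [a b] [a' b'] /andP[abV /eqP es] /andP[abV' /eqP es'].
move: abV abV'; rewrite !mem_sides => /and4P[aV bV _ _] /and4P[a'V b'V _ _].
have /= sa : (sigma d a', sigma d b').1 = (sigma d a, sigma d b).1.
  by rewrite -[LHS]/((sigma d (a', b').1, sigma d (a', b').2).1) es' -es.
have /= sb : (sigma d a', sigma d b').2 = (sigma d a, sigma d b).2.
  by rewrite -[LHS]/((sigma d (a', b').1, sigma d (a', b').2).2) es' -es.
by congr pair; apply: inj.
Qed.

Section Portraits.
Context {R : realType}.
Variables (d : nat) (G : set (R * R)) (i n : nat) (P : {fset R}) (xs ps : nat -> R).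
Let N := (n * i)%N.
Hypotheses (n_gt1 : (1 < n)%N) (polyP : polygon P) (cardP : #|` P| = n)
  (convG : segment_convex G)
  (xsC : cyclic_enum N xs) (psC : cyclic_enum n ps)
  (psP : forall p, (p \in P) <-> exists2 j, (j < n)%N & p = ps j)
  (xsP : forall k, (k < N)%N ->
    [/\ circle (xs k), G (pt (xs k)) & sigma d (xs k) = ps (k %% n)%N])
  (xs_onto : forall x, circle x -> G (pt x) -> sigma d x \in P ->
    exists2 k, (k < N)%N & x = xs k).

Let n_gt0 : (0 < n)%N := ltnW n_gt1.

Definition vertices (B : {set 'I_N}) : {fset R} := [fset xs k | k : 'I_N in B]%fset.

Definition portrait (pi : {set {set 'I_N}}) : {fset {fset R}} :=
  [fset vertices B | B : {set 'I_N} in pi]%fset.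

Let xsI (j k : 'I_N) : xs j = xs k -> j = k.
Proof. by move/(xsC.1 _ _ (ltn_ord j) (ltn_ord k))/val_inj. Qed.

Let verticesP (B : {set 'I_N}) x :
  reflect (exists2 k : 'I_N, k \in B & x = xs k) (x \in vertices B).
Proof. exact: imfsetP. Qed.

Let mem_vertices (B : {set 'I_N}) (k : 'I_N) : (xs k \in vertices B) = (k \in B).
Proof. by apply/verticesP/idP => [[j jB /xsI->]|kB] //; exists k. Qed.

Let vertices_inj : injective vertices.
Proof. by move=> A B e; apply/finset.setP => k; rewrite -!mem_vertices e. Qed.

Let card_vertices B : #|` vertices B| = #|B|.
Proof. by apply: card_imfset_finset => j k _ _; apply: xsI. Qed.

Let portrait_inj : injective portrait.
Proof.
move=> pi tau e; apply/finset.setP => B.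
have mem (rho : {set {set 'I_N}}) : (vertices B \in portrait rho) = (B \in rho).
  by apply/imfsetP/idP => [[A /= Ar /vertices_inj->]|Br] //; exists B.
by rewrite -!mem e.
Qed.

Let card_portrait pi : #|` portrait pi| = #|pi|.
Proof. by apply: card_imfset_finset => A B _ _; apply: vertices_inj. Qed.

Let vertices_circle B x : x \in vertices B -> circle x /\ G (pt x).
Proof. by case/verticesP => k _ ->; have [] := xsP (ltn_ord k). Qed.

Let polygon_vertices (B : {set 'I_N}) : (1 < #|B|)%N -> polygon (vertices B).
Proof.
by move=> cB; split; [move=> x /= /vertices_circle[]|rewrite card_vertices].
Qed.

Let ccw_xs (j k l : 'I_N) : ccw (xs j) (xs k) (xs l) = cyc j k l.
Proof. by apply: (ccw_cyc xsC). Qed.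

(** Say A has the smaller minimum.  Then B lies between two cyclically
    consecutive points of A, and the line through these separates the hulls. *)
Lemma noncrossing_blocks_disjoint_hulls (A B : {set 'I_N}) :
  (1 < #|A|)%N -> (1 < #|B|)%N ->
  (forall x, x \in A -> x \in B -> False) ->
  (forall x y z t : 'I_N, x \in A -> z \in A -> y \in B -> t \in B ->
    (x < y < z)%N -> (z < t)%N -> False) ->
  (forall x y z t : 'I_N, x \in B -> z \in B -> y \in A -> t \in A ->
    (x < y < z)%N -> (z < t)%N -> False) ->
  hull (vertices A) `&` hull (vertices B) = set0.
Proof.
move=> cA cB dis crAB crBA.
have min_ex (C : {set 'I_N}) : (1 < #|C|)%N ->
    exists2 m, m \in C & forall x, x \in C -> (m <= x)%N.
  move=> cC; have /card_gt0P[x0 x0C] := ltnW cC.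
  by case: (arg_minnP (P := mem C) (fun x : 'I_N => val x) x0C) => m mC mmin; exists m.
wlog ltmin : A B cA cB dis crAB crBA / exists a b : 'I_N,
    [/\ a \in A, b \in B, (a < b)%N, forall x, x \in A -> (a <= x)%N &
     forall x, x \in B -> (b <= x)%N].
  have [a aA amin] := min_ex A cA; have [b bB bmin] := min_ex B cB.
  move=> wl; case: (ltngtP a b) => ab.
  - by apply: wl => //; exists a, b.
  - rewrite setIC; apply: wl => //; first by move=> x xB xA; apply: dis xB.
    by exists b, a.
  - by case: (dis a aA); rewrite (_ : a = b) //; apply: val_inj.
have {min_ex} [a0 [b0 [a0A b0B a0b0 a0min b0min]]] := ltmin.
have [a [aA ab0 amax]] : exists a : 'I_N, [/\ a \in A, (a < b0)%N &
    forall x, x \in A -> (x < b0)%N -> (x <= a)%N].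
  case: (arg_maxnP (P := fun x : 'I_N => (x \in A) && (x < b0)%N) (fun x : 'I_N => val x) (i0 := a0)).
    by rewrite a0A.
  move=> a /andP[aA ab] amax; exists a; split=> // x xA xb.
  by apply: amax; rewrite xA.
have neqB x w : x \in A -> w \in B -> val x != val w.
  by move=> xA wB; apply/eqP => /val_inj e; apply: (dis x); rewrite // e.
have [[c0 /andP[c0A bc0]]|above] := pselect (exists x : 'I_N, (x \in A) && (b0 < x)%N).
  have [c [cinA b0c cmin]] : exists c : 'I_N, [/\ c \in A, (b0 < c)%N &
      forall x, x \in A -> (b0 < x)%N -> (c <= x)%N].
    case: (arg_minnP (P := fun x : 'I_N => (x \in A) && (b0 < x)%N) (fun x : 'I_N => val x) (i0 := c0)).
      by rewrite c0A.
    move=> c /andP[cinA cb] cmin; exists c; split=> // x xA xb.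
    by apply: cmin; rewrite xA.
  apply: (separated_hulls (a := xs a) (c := xs c)); rewrite ?mem_vertices //;
    try exact: polygon_vertices.
    move=> _ /verticesP[v vA ->]; rewrite ccw_xs.
    have nv := neqB v b0 vA b0B.
    case: (ltngtP v b0) nv => //= vb _.
      by have := amax v vA vb; rewrite /cyc; lia.
    by have := cmin v vA vb; rewrite /cyc; lia.
  move=> _ /verticesP[w wB ->]; rewrite ccw_xs /cyc.
  have bw := b0min w wB; have nc := neqB c w cinA wB.
  have wc : (w < c)%N.
    rewrite ltnNge; apply/negP => cw.
    apply: (crAB a b0 c w) => //; first by rewrite ab0.
    by rewrite ltn_neqAle nc.
  by lia.
have below v : v \in A -> (v < b0)%N.
  move=> vA; have nv := neqB v b0 vA b0B.
  case: (ltngtP v b0) nv => //= vb _.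
  by case: above; exists v; rewrite vA.
have a0a : (a0 < a)%N.
  rewrite ltnNge; apply/negP => aa0; move: cA; rewrite ltnNge => /negP; apply.
  rewrite -(cards1 a0); apply: subset_leq_card; apply/fintype.subsetP => x xA.
  rewrite inE; apply/eqP/val_inj/eqP; rewrite eqn_leq a0min // andbT.
  by apply: leq_trans aa0; apply: amax => //; apply: below.
apply: (separated_hulls (a := xs a) (c := xs a0)); rewrite ?mem_vertices //;
  try exact: polygon_vertices.
  move=> _ /verticesP[v vA ->]; rewrite ccw_xs.
  by have := a0min v vA; have := amax v vA (below v vA); rewrite /cyc; lia.
by move=> _ /verticesP[w wB ->]; rewrite ccw_xs /cyc; have := b0min w wB; lia.
Qed.

Let sigma_xs (k : 'I_N) : sigma d (xs k) = ps (k %% n)%N.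
Proof. by have [] := xsP (ltn_ord k). Qed.

Let mod_lt k : (k %% n < n)%N. Proof. by rewrite ltn_mod. Qed.

Let ps_mem j : (j < n)%N -> ps j \in P.
Proof. by move=> jn; apply/psP; exists j. Qed.

Let psN j k : (j < n)%N -> (k < n)%N -> ps j = ps k -> j = k.
Proof. exact: psC.1. Qed.

Let P_circle p : p \in P -> circle p.
Proof. by case: polyP => + _; apply. Qed.

Lemma families_full pi : noncrossing_family n N i pi ->
  finset.cover pi = finset.setTfor 'I_N.
Proof.
move=> h; apply/eqP; rewrite finset.eqEcard finset.subsetT /=.
by rewrite (family_card_cover h) finset.cardsT card_ord /N mulnC.
Qed.

(** Two points of a block differ, modulo n, by the number of points of the
    block from one to the other, which is less than n. *)
Lemma sigma_inj_block pi (B : {set 'I_N}) : noncrossing_family n N i pi ->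
  B \in pi -> {in vertices B &, injective (sigma d)}.
Proof.
move=> h Bpi _ _ /verticesP[j jB ->] /verticesP[k kB ->].
rewrite !sigma_xs => /psN e; have {e} := e (mod_lt _) (mod_lt _).
have full := families_full h.
have lt (j' k' : 'I_N) : j' \in B -> k' \in B -> (j' < k')%N ->
    (j' %% n <> k' %% n)%N.
  move=> jB' kB' jk; have [q ->] := block_gap h full Bpi jB' kB' (ltnW jk).
  set r := #|_|.
  have r0 : (0 < r)%N by apply/card_gt0P; exists j'; rewrite inE jB' leqnn.
  have rn : (r < n)%N.
    have [_ sz _ _ _] := h; have [<- _] := sz _ Bpi.
    rewrite (cardsD1 k') kB' add1n ltnS.
    apply: subset_leq_card; apply/fintype.subsetP => x; rewrite !inE.
    by case/and3P => -> _ h2; rewrite andbT; apply/eqP => xk; rewrite xk ltnn in h2.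
  rewrite addnC modnMDl -[in LHS](addn0 j') => /eqP.
  by rewrite eqn_modDl mod0n eq_sym modn_small // => /eqP r00; rewrite r00 in r0.
move=> e; have [jk|kj|/val_inj->//] := ltngtP j k.
  by case: (lt j k jB kB jk).
by case: (lt k j kB jB kj).
Qed.

Lemma image_block pi (B : {set 'I_N}) : noncrossing_family n N i pi ->
  B \in pi -> polygon_image d (vertices B) = P.
Proof.
move=> h Bpi; apply/eqP; rewrite eqEfcard; apply/andP; split.
  apply/fsubsetP => _ /imfsetP[_ /verticesP[k kB ->] ->].
  by rewrite sigma_xs; apply: ps_mem.
rewrite cardP card_in_imfset; last exact: sigma_inj_block h Bpi.
have [_ sz _ _ _] := h; have [<- _] := sz _ Bpi.
by rewrite -card_vertices.
Qed.

(** The map preserves the cyclic order of a block, so the preimages of the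
    endpoints of a side of P are consecutive in the block. *)
Lemma one_side_over_block pi (B : {set 'I_N}) s : noncrossing_family n N i pi ->
  B \in pi -> s \in sides P -> #|` sides_over d (vertices B) s| = 1%N.
Proof.
case: s => p q h Bpi; rewrite mem_sides => /and4P[pP qP pq empty].
have inj := sigma_inj_block h Bpi; have im := image_block h Bpi.
have lift r : r \in P -> exists2 k : 'I_N, k \in B & sigma d (xs k) = r.
  by rewrite -{1}im => /imfsetP[_ /verticesP[k kB ->] ->]; exists k.
have [[a aB sa] [b bB sb]] := (lift p pP, lift q qP).
have ab : xs a != xs b by apply: contraNneq pq => e; rewrite -sa -sb e.
apply/eqP; rewrite eqn_leq sides_over_le1 //= cardfs_gt0; apply/fset0Pn.
exists (xs a, xs b); rewrite mem_sides_over /= sa sb eqxx andbT mem_sides ab.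
rewrite !mem_vertices aB bB /=; apply/allP => _ /verticesP[k kB ->].
have circ (j : 'I_N) : circle (xs j) by have [] := xsP (ltn_ord j).
rewrite in_arcE ?circ // ccw_xs; apply/negP => akb.
have := block_residues_cyc h (families_full h) Bpi aB kB bB akb.
rewrite -(ccw_cyc psC) // -!sigma_xs sa sb => c3.
have kP : sigma d (xs k) \in P by rewrite sigma_xs ps_mem.
by have := allP empty _ kP; rewrite in_arcE ?c3 //; apply: P_circle.
Qed.

Lemma portrait_of_family pi : noncrossing_family n N i pi ->
  one_to_one_portraits d G i P (portrait pi).
Proof.
move=> h; have [cpi sz dis cr _] := h.
have c1 B : B \in pi -> (1 < #|B|)%N by move=> /sz[->].
split; last by move=> V /imfsetP[B /= Bpi ->]; apply: sigma_inj_block h Bpi.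
split=> [_ /imfsetP[B /= Bpi ->]|_ _ /imfsetP[A /= Api ->] /imfsetP[B /= Bpi ->] AB|s sP].
- split; [by apply/polygon_vertices/c1| |exact: image_block h Bpi].
  by apply: hull_sub => // v /vertices_circle[].
- have {}AB : A <> B by move=> e; rewrite e eqxx in AB.
  apply: noncrossing_blocks_disjoint_hulls; [exact: c1|exact: c1| | |].
  + by move=> x xA xB; apply: AB; apply: (dis _ _ x).
  + by move=> x y z t xA zA yB tB xyz zt; apply: AB; apply: (cr A B x y z t).
  + by move=> x y z t xA zA yB tB xyz zt; apply: AB; apply/esym/(cr B A x y z t).
- rewrite -cpi -card_portrait -sum1_size !big_seq; apply: eq_bigr => _ /imfsetP[B /= Bpi ->].
  exact: one_side_over_block h Bpi sP.
Qed.

(** Counting the sides over one side of P gives at least i polygons, and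
    counting vertices gives at most i; hence no preimage is left unmatched. *)
Lemma family_of_portrait Q : one_to_one_portraits d G i P Q ->
  exists2 pi, noncrossing_family n N i pi & Q = portrait pi.
Proof.
move=> [[poly disj cnt] inj].
pose pi : {set {set 'I_N}} := [set B | vertices B \in Q]%SET.
have piP (B : {set 'I_N}) : (B \in pi) = (vertices B \in Q) by rewrite inE.
have Qpi : Q = portrait pi.
  apply/fsetP => V; apply/idP/imfsetP => [VQ|[B /= + ->]]; last by rewrite piP.
  have [[Vc _] VG im] := poly V VQ.
  pose B : {set 'I_N} := [set k : 'I_N | xs k \in V]%SET.
  suff e : V = vertices B by exists B; rewrite //= piP -e.
  apply/fsetP => x; apply/idP/verticesP => [xV|[k + ->]]; last by rewrite inE.
  have sP : sigma d x \in P by rewrite -im; apply/imfsetP; exists x.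
  have [k kN xk] := xs_onto (Vc _ xV) (VG _ (pt_hull xV)) sP.
  by exists (Ordinal kN); rewrite ?inE /= -?xk.
exists pi => //.
have sz B : B \in pi -> #|B| = n.
  rewrite piP => BQ; have [_ _ im] := poly _ BQ.
  by rewrite -card_vertices -cardP -im [RHS]card_in_imfset //; exact: (inj _ BQ).
have dis (A B : {set 'I_N}) x : A \in pi -> B \in pi -> x \in A -> x \in B -> A = B.
  rewrite !piP => AQ BQ xA xB; apply: vertices_inj; apply/eqP/negPn/negP => AB.
  have := disj _ _ AQ BQ AB; apply/eqP/set0P; exists (pt (xs x)).
  by split; apply: pt_hull; rewrite mem_vertices.
have tr : finset.trivIset pi.
  apply/finset.trivIsetP => A B Api Bpi AB; apply/pred0P => x /=.
  by apply/negP => /andP[xA xB]; move/eqP: AB; apply; apply: (dis _ _ x).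
have card_cov : #|finset.cover pi| = (#|pi| * n)%N.
  rewrite -(eqP tr) -sum_nat_const; apply: eq_bigr => B; exact: sz.
(* Any one side of P will do for the count. *)
have s01 : (ps 0%N, ps 1%N) \in sides P.
  rewrite mem_sides !ps_mem //=; apply/andP; split.
    by apply/eqP => /psN; move=> /(_ n_gt0 n_gt1).
  apply/allP => r rP; have [j jn ->] := iffLR (psP r) rP.
  have circ k : (k < n)%N -> circle (ps k) by move=> kn; apply/P_circle/ps_mem.
  rewrite in_arcE; try exact: circ.
  by rewrite (ccw_cyc psC) // /cyc; lia.
have pi_ge : (i <= #|pi|)%N.
  rewrite -(cnt _ s01) -card_portrait -Qpi -sum1_size !big_seq.
  by apply: leq_sum => V VQ; apply: sides_over_le1; apply: inj.
have pi_le : (#|pi| <= i)%N.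
  have := max_card (mem (finset.cover pi)); rewrite card_ord card_cov /N mulnC.
  by rewrite leq_pmul2l.
have cpi : #|pi| = i by apply/eqP; rewrite eqn_leq pi_le.
split=> //.
- by move=> B Bpi; split; [exact: sz|].
- move=> A B x y z t Api Bpi xA zA yB tB xyz zt.
  have c1 C : C \in pi -> (1 < #|C|)%N by move=> /sz->.
  apply: vertices_inj; apply/eqP/negPn/negP => AB.
  have := disj _ _ _ _ AB; rewrite -!piP => /(_ Api Bpi).
  apply/eqP/set0P; apply: (crossing_hulls (a := xs x) (c := xs z) (b := xs y) (e := xs t));
    rewrite ?mem_vertices //; try by apply/polygon_vertices/c1.
    by rewrite ccw_xs /cyc xyz.
  by rewrite ccw_xs /cyc zt andbT; move: xyz; lia.
- move=> B x u y _ _ _ _.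
  suff -> : finset.cover pi = finset.setTfor 'I_N by rewrite inE.
  apply/eqP; rewrite finset.eqEcard finset.subsetT /= card_cov cpi.
  by rewrite finset.cardsT card_ord /N mulnC.
Qed.

Lemma portraits_families :
  one_to_one_portraits d G i P =
  [set` [fset portrait pi | pi : {set {set 'I_N}} in families n N i]%fset].
Proof.
apply/seteqP; split=> Q.
  move=> /family_of_portrait[pi h ->]; apply/imfsetP; exists pi => //=.
  exact/familiesP.
by move=> /imfsetP[pi /= /familiesP h ->]; apply: portrait_of_family.
Qed.

(** For k = n * i and b = i the first factor of [card_families] is 1, and
    'C(N + 1, i) is reduced to 'C(N, i). *)
Lemma card_portraits :
  finite_set (one_to_one_portraits d G i P) /\
  (#|` fset_set (one_to_one_portraits d G i P)| * ((n - 1) * i + 1) = 'C(N, i))%N.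
Proof.
rewrite portraits_families; split; first exact: finite_fset.
rewrite set_fsetK card_imfset_finset; last by move=> pi tau _ _; apply: portrait_inj.
have /= := @card_families N n N i n_gt0 (leqnn N).
rewrite (_ : N.+1 - i * n = 1)%N; last by rewrite /N mulnC subSnn.
rewrite mul1n => h.
have iN : (i <= N)%N by rewrite /N leq_pmull.
have e : ((n - 1) * i + 1 = N.+1 - i)%N by rewrite mulnBl mul1n -/N addn1 subSn.
apply/eqP; rewrite -(eqn_pmul2r (ltn0Sn N)) mulnAC h e; apply/eqP.
rewrite [RHS]mulnC (mulnC 'C(N.+1, i)).
by have := mul_bin_down N.+1 i; rewrite /= => <-.
Qed.

End Portraits.

Theorem theorem3p1 (R : realType) (d : nat) (L G : set (R * R)) (i n : nat)
    (P : {fset R}) :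
  (2 <= d)%N ->
  lamination L -> round_gap L G ->
  (1 <= i)%N -> gap_degree d L G i ->
  (2 <= n)%N -> polygon P -> #|` P| = n -> hull P `<=` gap_image d L G ->
  finite_set (one_to_one_portraits d G i P) /\
  #|` fset_set (one_to_one_portraits d G i P)|%:R =
    'C(n * i, i)%:R / ((n - 1) * i + 1)%:R :> rat.
Proof.
move=> _ lamL gapG _ deg n2 polyP cardP PG.
have [xs [ps [xsC psC psP xsP xs_onto]]] :=
  portrait_vertices lamL gapG deg (ltnW n2) polyP cardP PG.
have convG : segment_convex G.
  by case: gapG => -[z [zO ->]] _; apply: gap_segment_convex.
have [fin card] := card_portraits n2 polyP cardP convG xsC psC psP xsP xs_onto.
by split=> //; rewrite -card natrM mulfK.
Qed.
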